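(* Let $D_{in}$ and $D_{out}$ be arbitrary positive integers, let $\rho:\mathbb{R}\to\mathbb{R}$ be a piecewise $C^1$ function with $\rho'\in BV(\mathbb{R})$, and let $\epsilon>0$. Then there exists a meromorphic function $\sigma:\mathcal{D}\to\mathbb{C}$, defined on an open set $\mathcal{D}\subset\mathbb{C}$ with $\mathcal{D}\supset\mathbb{R}$, with $\sigma(\mathbb{R})\subset\mathbb{R}$, such that $\|\rho-\sigma\|_{L^\infty(\mathbb{R})}<\epsilon$ and $(\mathscr{N}^{D_{in},D_{out}}_{nc},\sigma)$ is identifiable up to $\simeq$.
   Context: $BV(\mathbb{R})=\{f\in L^1(\mathbb{R}): \sup\{\int_\mathbb{R} f\varphi'\,dx : \varphi\in C^1_c(\mathbb{R}),\ \|\varphi\|_{L^\infty}\le 1\}<\infty\}$. A neural network is a tuple $\mathcal{N}=(D_0,D_1,\dots,D_L;W^1,\theta^1,\dots,W^L,\theta^L)$ where $L\ge1$ is an integer (the depth), $D_0,\dots,D_L$ are positive integers (the layout), $W^\ell\in\mathbb{R}^{D_\ell\times D_{\ell-1}}$ (weights) and $\theta^\ell\in\mathbb{R}^{D_\ell}$ (biases), and no $W^\ell$ has an identically zero row or an identically zero column. For a nonlinearity $\rho:\mathbb{R}\to\mathbb{R}$ the map realized by $\mathcal{N}$ is $\mathcal{N}^\rho:\mathbb{R}^{D_0}\to\mathbb{R}^{D_L}$, $\mathcal{N}^\rho(x)=\rho(W^L(\rho(W^{L-1}(\cdots\rho(W^1x+\theta^1)\cdots)+\theta^{L-1}))+\theta^L)$,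 with $\rho$ acting componentwise. $\mathscr{N}^{D_{in},D_{out}}$ is the set of all neural networks with $D_0=D_{in}$ and $D_L=D_{out}$ (depth and other layout entries arbitrary). A network has a clone pair if there are $\ell\in\{1,\dots,L\}$ and $j\neq j'$ with $(\theta^\ell_j,W^\ell_{j1},\dots,W^\ell_{jD_{\ell-1}})=(\theta^\ell_{j'},W^\ell_{j'1},\dots,W^\ell_{j'D_{\ell-1}})$; otherwise it satisfies the no-clones condition. $\mathscr{N}^{D_{in},D_{out}}_{nc}$ is the set of networks in $\mathscr{N}^{D_{in},D_{out}}$ satisfying the no-clones condition. Two networks $\mathcal{N},\widetilde{\mathcal{N}}$ are isomorphic, $\mathcal{N}\simeq\widetilde{\mathcal{N}}$, if $L=\widetilde L$, they have the same layout, and there are permutations $\gamma_\ell$ of $\{1,\dots,D_\ell\}$, with $\gamma_0$ and $\gamma_L$ the identity, such that $\widetilde W^\ell_{jk}=W^\ell_{\gamma_\ell(j)\gamma_{\ell-1}(k)}$ and $\widetilde\theta^\ell_j=\theta^\ell_{\gamma_\ell(j)}$ for all $\ell,j,k$. For a set $\mathscr{N}\subset\mathscr{N}^{D_{in},D_{out}}$, a nonlinearity $\rho$ and an equivalence relation $\sim$, $(\mathscr{N},\rho)$ is identifiable up to $\sim$ if for all $\mathcal{N}_1,\mathcal{N}_2\in\mathscr{N}$, $\mathcal{N}_1^\rho(x)=\mathcal{N}_2^\rho(x)$ for all $x\in\mathbb{R}^{D_{in}}$ implies $\mathcal{N}_1\sim\mathcal{N}_2$. (Here $\sigma$ is used as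 a nonlinearity via its restriction to $\mathbb{R}$.) *)

(* Defs.v *)
From HB Require Import structures.
From mathcomp Require Import all_boot all_order all_algebra.
From mathcomp Require Import perm complex.
From mathcomp Require Import all_classical all_reals all_analysis.

Set Implicit Arguments.
Unset Strict Implicit.
Unset Printing Implicit Defensive.

Import Order.TTheory GRing.Theory Num.Theory.
Import numFieldNormedType.Exports.

Local Open Scope ring_scope.
Local Open Scope complex_scope.
Local Open Scope classical_set_scope.

Section RealFunctions.
Context {R : realType}.
Local Notation mu := (@lebesgue_measure R).

Definition C1 (f : R -> R) : Prop :=
  (forall x, derivable f x 1) /\ continuous (derive1 f).

Definition C1c (f : R -> R) : Prop :=
  C1 f /\ compact (closure [set x | f x != 0]).

Definition BV (f : R -> R) : Prop :=
  mu.-integrable setT (EFin \o f) /\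
  (ereal_sup [set \int[mu]_x (f x * derive1 phi x)%:E
             | phi in [set phi : R -> R |
                 C1c phi /\ ('N[mu]_+oo [EFin \o phi] <= 1)%E]] < +oo)%E.

(* [S] is the set of breakpoints, locally finite in R; the one-sided limits of
   the derivative at the breakpoints express that [f] is C^1 on each closed
   piece. Continuity of [f] is part of the notion. *)
Definition piecewise_C1 (f : R -> R) : Prop :=
  continuous f /\
  exists S : set R,
    [/\ forall a b, finite_set (S `&` `[a, b]),
        forall x, ~ S x -> derivable f x 1 /\ {for x, continuous (derive1 f)} &
        forall x, S x -> cvg (derive1 f @ x^'-) /\ cvg (derive1 f @ x^'+)].

End RealFunctions.

Section ComplexFunctions.
Context {R : realType}.

(* [derivable] is taken over the scalar field R[i], i.e. it is complex
   differentiability. *)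
Definition holomorphic_at (f : R[i]^o -> R[i]^o) (z : R[i]^o) : Prop :=
  \forall w \near z, derivable f w 1.

(* A pole of order [n.+1]; the value of [f] at the pole is irrelevant. *)
Definition pole (f : R[i]^o -> R[i]^o) (p : R[i]^o) : Prop :=
  (\forall w \near p^', derivable f w 1) /\
  exists n : nat, exists2 c : R[i]^o, c != 0 &
    (w - p) ^+ n.+1 * f w @[w --> p^'] --> c.

Definition meromorphic_on (D : set R[i]^o) (f : R[i]^o -> R[i]^o) : Prop :=
  forall z, D z -> holomorphic_at f z \/ pole f z.

End ComplexFunctions.

Section Networks.
Context {R : realType}.

(* [network m n] is the type of tuples (D_0, ..., D_L; W^1, theta^1, ..., W^L,
   theta^L) with L >= 1, D_0 = m and D_L = n: [Layer] is the case L = 1, and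
   [Snoc] appends the last layer. The conditions on the D_l and W^l are in
   [network_axioms]. *)
Inductive network (m : nat) : nat -> Type :=
| Layer n of 'M[R]_(n, m) & 'cV[R]_n : network m n
| Snoc k n of network m k & 'M[R]_(n, k) & 'cV[R]_n : network m n.

Fixpoint realize (rho : R -> R) m n (N : network m n) (x : 'cV[R]_m) :
    'cV[R]_n :=
  match N with
  | Layer _ W theta => map_mx rho (W *m x + theta)
  | Snoc _ _ N' W theta => map_mx rho (W *m realize rho N' x + theta)
  end.

Definition no_zero_row_col m n (W : 'M[R]_(n, m)) : Prop :=
  (forall j, row j W != 0) /\ (forall k, col k W != 0).

Fixpoint network_axioms m n (N : network m n) : Prop :=
  match N with
  | Layer n W _ => [/\ (0 < m)%N, (0 < n)%N & no_zero_row_col W]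
  | Snoc _ n N' W _ => [/\ network_axioms N', (0 < n)%N & no_zero_row_col W]
  end.

Definition clone_pair m n (W : 'M[R]_(n, m)) (theta : 'cV[R]_n) : Prop :=
  exists j j' : 'I_n,
    [/\ j != j', theta j 0 = theta j' 0 & forall k, W j k = W j' k].

Fixpoint has_clone_pair m n (N : network m n) : Prop :=
  match N with
  | Layer _ W theta => clone_pair W theta
  | Snoc _ _ N' W theta => has_clone_pair N' \/ clone_pair W theta
  end.

Definition networks_nc m n : set (network m n) :=
  [set N | network_axioms N /\ ~ has_clone_pair N].

(* [iso_rel g N N']: same depth and layout, and there are permutations
   gamma_0 = 1, gamma_1, ..., gamma_(L-1), gamma_L = g carrying N to N'. *)
Inductive iso_rel m :
    forall n, {perm 'I_n} -> network m n -> network m n -> Prop :=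
| iso_Layer n (g : {perm 'I_n}) (W W' : 'M[R]_(n, m)) (theta theta' : 'cV[R]_n) :
    (forall j k, W' j k = W (g j) k) ->
    (forall j, theta' j 0 = theta (g j) 0) ->
    iso_rel g (Layer W theta) (Layer W' theta')
| iso_Snoc k n (h : {perm 'I_k}) (g : {perm 'I_n}) (N N' : network m k)
    (W W' : 'M[R]_(n, k)) (theta theta' : 'cV[R]_n) :
    iso_rel h N N' ->
    (forall j i, W' j i = W (g j) (h i)) ->
    (forall j, theta' j 0 = theta (g j) 0) ->
    iso_rel g (Snoc N W theta) (Snoc N' W' theta').

Definition isomorphic m n (N N' : network m n) : Prop :=
  iso_rel (perm_one 'I_n) N N'.

Definition identifiable m n (S : set (network m n)) (rho : R -> R)
    (sim : network m n -> network m n -> Prop) : Prop :=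
  forall N1 N2, S N1 -> S N2 ->
    (forall x : 'cV[R]_m, realize rho N1 x = realize rho N2 x) -> sim N1 N2.

End Networks.
Arguments network R m n : clear implicits.
Arguments networks_nc R m n : clear implicits.

(* Main.v *)
Require Import Defs.
From HB Require Import structures.
From mathcomp Require Import all_boot all_order all_algebra.
From mathcomp Require Import perm complex.
From mathcomp Require Import all_classical all_reals all_analysis.
From mathcomp Require Import ring lra polyrcf.
Import Order.TTheory GRing.Theory Num.Theory.
Import numFieldNormedType.Exports.
Set Implicit Arguments.
Unset Strict Implicit.
Unset Printing Implicit Defensive.
Local Open Scope ring_scope.
Local Open Scope complex_scope.
Local Open Scope classical_set_scope.

(** With [h x = exp (- exp (- x))], which maps R increasingly onto ]0, 1[, take
    the entire function
      [sigma x = P (h x) + delta * sin (exp (x ^ 4 + x))],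
    where the polynomial [P] comes from the Weierstrass theorem: [rho] has
    limits at both ends because its derivative is integrable, so [P \o h] can
    be made uniformly close to [rho].

    Along a generic line [t |-> t v] the neurons of a clone-free first layer are
    [sigma (a_j t + b_j)] with distinct (a_j, b_j) and a_j <> 0. The phases
    [exp ((a_j t + b_j) ^ 4 + a_j t + b_j)] have pairwise different orders of
    growth, so their sines become independent as t tends to infinity: the values
    of the layer accumulate on a whole box. A real-analytic relation between the
    neurons thus vanishes on a box, hence everywhere, and by induction on the
    depth the output neurons of a clone-free network satisfy no analytic
    relation at all.

    Two networks of the same depth are merged, layer by layer, into one
    clone-free network containing both; if they realize the same map,
    independence forces their output neurons to coincide in the merged network,
    so they are isomorphic. For different depths, independence would make a
    coordinate function equal to a bounded function. *)

(** * Real-analytic functions of one variable *)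

Section Analytic.
Variable R : realType.
Implicit Types (f g : R -> R) (T G H : nat -> R -> R).

(** [T n] plays the role of f^(n) / n!. With this normalisation real-analyticity on the whole line
    is a geometric bound, uniform in [n], on every bounded interval. The exponent [n.+1] lets the
    same [K] bound the function itself. *)
Definition taylor T : Prop :=
  (forall n (y : R), is_derive y 1 (T n) (n.+1%:R * T n.+1 y)) /\
  (forall A : R, exists2 K : R, 1 <= K &
    forall n (y : R), `|y| <= A -> `|T n y| <= K ^+ n.+1).

Definition analytic f : Prop := exists2 T, taylor T & T 0%N = f.

Lemma analytic_continuous f : analytic f -> continuous f.
Proof.
move=> [T [dT _] <-] y; apply: differentiable_continuous.
by apply/derivable1_diffP; have [] := dT 0%N y.
Qed.

Lemma exprn_analytic k : analytic (fun x => x ^+ k).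
Proof.
exists (fun n y => 'C(k, n)%:R * y ^+ (k - n)); last first.
  by apply/funext => y; rewrite bin0 mul1r subn0.
split=> [n y|A].
  rewrite (_ : (fun _ => _) = 'C(k, n)%:R \*: (@id R) ^+ (k - n)).
    2: by apply/funext => z; rewrite /= fctE.
  apply: is_derive_eq; rewrite /= /GRing.scale /= mulr1.
  by rewrite [RHS]mulrA -natrM mul_bin_left natrM subnS mulrA [_%:R * _%:R]mulrC.
have A1 : 1 <= 1 + `|A| by rewrite lerDl.
exists (2 ^+ k * (1 + `|A|) ^+ k) => [|n y yA].
  by apply: mulr_ege1; apply: exprn_ege1 => //; lra.
have K1 : 1 <= 2 ^+ k * (1 + `|A|) ^+ k :> R.
  by apply: mulr_ege1; apply: exprn_ege1 => //; lra.
rewrite exprS; apply: le_trans (ler_peMr (le_trans ler01 K1) (exprn_ege1 n K1)).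
rewrite normrM normr_nat normrX; apply: ler_pM => //.
  (* The binomial coefficient is one term of the expansion of (1 + 1)^k. *)
  rewrite -natrX ler_nat -[X in (_ <= X)%N]/((1 + 1) ^ k)%N expnDn.
  have [kn|kn] := ltnP k n; first by rewrite bin_small.
  rewrite (bigD1 (Ordinal (kn : (n < k.+1)%N))) //=.
  by rewrite !exp1n !muln1 leq_addr.
apply: (@le_trans _ _ ((1 + `|A|) ^+ (k - n))).
  apply: lerXn2r; rewrite ?nnegrE ?addr_ge0//.
  by apply: (le_trans yA); apply: (le_trans (ler_norm A)); rewrite lerDr.
by apply: ler_weXn2l => //; exact: leq_subr.
Qed.

Lemma analytic_id : analytic id.
Proof.
by rewrite (_ : id = fun x => x ^+ 1); [exact: exprn_analytic|apply/funext].
Qed.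

Lemma analyticZ c f : analytic f -> analytic (fun x => c * f x).
Proof.
move=> [T [dT bT] <-]; exists (fun n y => c * T n y) => //; split=> [n y|A].
  rewrite (_ : (fun _ => _) = c \*: T n) //.
  by have := dT n y => ?; apply: is_derive_eq; rewrite /GRing.scale /= mulrCA.
have [K K1 bK] := bT A.
have c1 : 1 <= 1 + `|c| by rewrite lerDl.
exists ((1 + `|c|) * K); first exact: mulr_ege1.
move=> n y yA; rewrite normrM exprMn; apply: ler_pM => //; last exact: bK.
apply: (@le_trans _ _ (1 + `|c|)); first by rewrite lerDr.
by rewrite -[X in X <= _]expr1; apply: ler_weXn2l.
Qed.

Lemma analyticD f g : analytic f -> analytic g -> analytic (fun x => f x + g x).
Proof.
move=> [T [dT bT] <-] [G [dG bG] <-].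
exists (fun n y => T n y + G n y) => //; split=> [n y|A].
  rewrite (_ : (fun _ => _) = T n + G n) //.
  have := dT n y => ?; have := dG n y => ?.
  by apply: is_derive_eq; rewrite mulrDr.
have [K K1 bK] := bT A; have [L L1 bL] := bG A.
exists (K + L) => [|n y yA]; first by lra.
apply: (le_trans (ler_normD _ _)); apply: (le_trans (lerD (bK _ _ yA) (bL _ _ yA))).
have {bK bL} := K1; elim: n => [|n IHn] _; first by rewrite !expr1.
rewrite exprS (exprS L) (exprS (K + L)).
apply: le_trans (ler_wpM2l _ (IHn K1)); last by lra.
have : 0 <= L * K ^+ n.+1 by rewrite mulr_ge0 ?exprn_ge0//; lra.
have : 0 <= K * L ^+ n.+1 by rewrite mulr_ge0 ?exprn_ge0//; lra.
by lra.
Qed.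

Lemma analytic_cst c : analytic (fun=> c).
Proof.
have := analyticZ c (exprn_analytic 0).
by congr analytic; apply/funext => x; rewrite expr0 mulr1.
Qed.

Lemma analytic_sum n (F : 'I_n -> R -> R) :
  (forall i, analytic (F i)) -> analytic (fun x => \sum_(i < n) F i x).
Proof.
elim: n F => [|n IHn] F aF.
  have := analytic_cst 0.
  by congr analytic; apply/funext => x; rewrite big_ord0.
have := analyticD (aF ord0) (IHn _ (fun i => aF (lift ord0 i))).
by congr analytic; apply/funext => x; rewrite big_ord_recl.
Qed.

Lemma mul_factV n : n.+1%:R * (n.+1)`!%:R^-1 = n`!%:R^-1 :> R.
Proof. by rewrite factS natrM invfM mulrA mulfV ?mul1r// pnatr_eq0. Qed.

Lemma expR_analytic : analytic expR.
Proof.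
exists (fun n y => n`!%:R^-1 * expR y); last first.
  by apply/funext => y; rewrite fact0 invr1 mul1r.
split=> [n y|A].
  rewrite (_ : (fun _ => _) = n`!%:R^-1 \*: @expR R) //.
  by apply: is_derive_eq; rewrite /GRing.scale /= mulrA mul_factV.
exists (expR `|A|) => [|n y yA]; first by rewrite -expR0 ler_expR.
rewrite normrM ger0_norm ?invr_ge0 ?ler0n// (ger0_norm (expR_ge0 _)).
apply: (@le_trans _ _ (expR `|A|)).
  rewrite -[X in _ <= X]mul1r; apply: ler_pM; rewrite ?expR_ge0 ?invr_ge0 ?ler0n//.
    by rewrite invf_le1 ?ltr0n ?fact_gt0// ler1n fact_gt0.
  by rewrite ler_expR; apply: (le_trans (ler_norm y)); exact: (le_trans yA (ler_norm _)).
by rewrite -[X in X <= _]expr1; apply: ler_weXn2l => //; rewrite -expR0 ler_expR.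
Qed.

Lemma sin_analytic : analytic sin.
Proof.
(* Each differentiation of the sine is a shift by a quarter period. *)
pose u n (y : R) := sin (y + n%:R * (pi / 2)).
exists (fun n y => n`!%:R^-1 * u n y); last first.
  by apply/funext => y; rewrite fact0 invr1 mul1r /u mul0r addr0.
split=> [n y|A].
  rewrite (_ : (fun _ => _) = n`!%:R^-1 \*: (sin \o (id + cst (n%:R * (pi / 2))))) //.
  apply: is_derive_eq; rewrite /GRing.scale /= addr0 mulr1.
  rewrite [RHS]mulrA mul_factV; congr (_ * _).
  have e : n.+1%:R * (pi / 2) = n%:R * (pi / 2) + pi / 2 :> R.
    by rewrite -(natr1 n) mulrDl mul1r.
  by rewrite /u e addrA [in RHS]sinD cos_pihalf sin_pihalf mulr0 add0r mulr1.
exists 1 => // n y _; rewrite expr1n normrM ger0_norm ?invr_ge0 ?ler0n//.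
rewrite -[X in _ <= X]mul1r; apply: ler_pM; rewrite ?invr_ge0 ?ler0n//.
  by rewrite invf_le1 ?ltr0n ?fact_gt0// ler1n fact_gt0.
by rewrite ler_norml sin_geN1 sin_le1.
Qed.

(** * Taylor coefficients of a composition *)

Section Composition.
Variables (H G : nat -> R -> R).

(* [comp_tab N n m] with [n <= N] is the n-th Taylor coefficient function of
   [H m \o G 0]; the recursion is the Leibniz formula for
   (H m \o G 0)' = (m + 1) (H (m + 1) \o G 0) G 1. *)
Fixpoint comp_tab (N n m : nat) (y : R) : R :=
  if N is N'.+1 then
    if (n <= N')%N then comp_tab N' n m y else
    m.+1%:R / N%:R *
      \sum_(k < N) k.+1%:R * G k.+1 y * comp_tab N' (N' - k) m.+1 y
  else H m (G 0%N y).

Definition comp_coef n m y := comp_tab n n m y.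

Lemma comp_tabE N n m y : (n <= N)%N -> comp_tab N n m y = comp_coef n m y.
Proof.
elim: N => [|N IHN]; first by rewrite leqn0 => /eqP ->.
rewrite leq_eqVlt => /orP[/eqP -> //|]; rewrite ltnS => nN /=.
by rewrite nN IHN.
Qed.

Lemma comp_coef0 m y : comp_coef 0 m y = H m (G 0%N y).
Proof. by []. Qed.

Lemma comp_coefS n m y : comp_coef n.+1 m y = m.+1%:R / n.+1%:R *
  \sum_(k < n.+1) k.+1%:R * G k.+1 y * comp_coef (n - k) m.+1 y.
Proof.
rewrite /comp_coef /= ltnn; congr (_ * _); apply: eq_bigr => k _.
by rewrite comp_tabE// leq_subr.
Qed.

(** Coefficient of order n in A' B + A B' = (A B)', for formal power series A and B with
    coefficients [a] and [b]. *)
Lemma leibniz_sum (a b : nat -> R) n :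
  \sum_(k < n.+1) (k.+1%:R * a k.+1 * b (n - k)%N
                   + a k * ((n - k).+1%:R * b (n - k).+1)) =
  n.+1%:R * \sum_(k < n.+2) a k * b (n.+1 - k)%N.
Proof.
rewrite big_split /= mulr_sumr.
transitivity (\sum_(k < n.+2) (k%:R * (a k * b (n.+1 - k)%N)
   + (n.+1 - k)%:R * (a k * b (n.+1 - k)%N))); last first.
  apply: eq_bigr => k _; rewrite -mulrDl -natrD subnKC//.
  by rewrite -ltnS.
rewrite big_split /=; congr (_ + _).
  rewrite [RHS]big_ord_recl mul0r add0r; apply: eq_bigr => k _.
  by rewrite /= /bump /= add1n mulrA subSS.
rewrite [RHS]big_ord_recr /= subnn mul0r addr0; apply: eq_bigr => k _.
by rewrite mulrCA subSn// -ltnS.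
Qed.

Hypotheses (tH : taylor H) (tG : taylor G).

(** Strong induction on n for all m at once. The recursion is differentiated term by term, and
    [leibniz_sum] recombines the terms into the next coefficient. *)
Lemma comp_coef_derive n m (y : R) :
  is_derive y 1 (comp_coef n m) (n.+1%:R * comp_coef n.+1 m y).
Proof.
have [dH _] := tH; have [dG _] := tG.
elim/ltn_ind: n m => -[_ m|n IHn m].
  rewrite (_ : comp_coef 0 m = H m \o G 0%N) //.
  have ? := dG 0%N y; have ? := dH m (G 0%N y).
  apply: is_derive_eq; rewrite comp_coefS big_ord1 /= comp_coef0; by field.
rewrite (_ : comp_coef n.+1 m = (m.+1%:R / n.+1%:R) \*:
    (\sum_(k < n.+1) (k.+1%:R \*: (G k.+1 * comp_coef (n - k) m.+1)))); last first.
  apply/funext => z; rewrite comp_coefS; congr (_ * _).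
  by rewrite fct_sumE; apply: eq_bigr => k _; rewrite -mulrA.
have dk (k : 'I_n.+1) : is_derive y 1 (k.+1%:R \*: (G k.+1 * comp_coef (n - k) m.+1))
   (k.+1%:R * (G k.+1 y * ((n - k).+1%:R * comp_coef (n - k).+1 m.+1 y)
     + comp_coef (n - k) m.+1 y * (k.+2%:R * G k.+2 y))).
  have nk : (n - k < n.+1)%N by rewrite ltnS leq_subr.
  have ? := IHn _ nk m.+1; have ? := dG k.+1 y.
  exact: is_derive_eq.
apply: is_derive_eq; rewrite /GRing.scale /=.
rewrite comp_coefS.
have := leibniz_sum (fun k => k.+1%:R * G k.+1 y) (fun k => comp_coef k m.+1 y) n.
set S := \sum_(k < n.+2) _ => e.
rewrite [X in _ * X](_ : _ = n.+1%:R * S); last first.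
  by rewrite -e; apply: eq_bigr => k _; ring.
rewrite mulrA divfK ?pnatr_eq0// [RHS]mulrA [n.+2%:R * _]mulrC.
by rewrite divfK ?pnatr_eq0.
Qed.

Lemma geometric_sum_le (x D : R) n :
  0 <= x -> 0 <= D -> x * (1 + D) <= D -> \sum_(k < n) x ^+ k.+1 <= D.
Proof.
move=> x0 D0 xD; elim: n => [|n IHn]; first by rewrite big_ord0.
rewrite big_ord_recl expr1; under eq_bigr do rewrite exprS.
rewrite -mulr_sumr; nra.
Qed.

(** Induction on n for all m. The factor (m + 1) / (n + 1) is absorbed by (n + 1) C(m + n + 1, n +
    1) = (m + 1) C(m + 1 + n, n), and the 2 in [s] pays for k + 1 <= 2^(k + 1). The factor 1 + K L
    in [s] leaves a geometric series of ratio 1 / (1 + K L), whose sum 1 / (K L) compensates the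
    extra K and L. *)
Lemma comp_coef_bound (A K L : R) : 1 <= K -> 1 <= L ->
  (forall m y, `|y| <= L -> `|H m y| <= K ^+ m.+1) ->
  (forall k y, `|y| <= A -> `|G k y| <= L ^+ k.+1) ->
  forall n m y, `|y| <= A ->
  `|comp_coef n m y| <= K ^+ m.+1 * 'C(m + n, n)%:R * (2 * L * (1 + K * L)) ^+ n.
Proof.
move=> K1 L1 bH bG n m y yA; set s := 2 * L * (1 + K * L).
have KL1 : 1 <= K * L by exact: mulr_ege1.
have s0 : 0 < s by rewrite /s; nra.
elim/ltn_ind: n m => -[_ m|n IHn m].
  rewrite comp_coef0 bin0 expr0 !mulr1; apply: bH.
  by have := bG 0%N y yA; rewrite expr1.
rewrite comp_coefS normrM.
have -> : `|m.+1%:R / n.+1%:R| = m.+1%:R / n.+1%:R :> R.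
  by rewrite ger0_norm// divr_ge0.
rewrite mulrAC ler_pdivrMr ?ltr0n//.
have -> : K ^+ m.+1 * 'C(m + n.+1, n.+1)%:R * s ^+ n.+1 * n.+1%:R =
    m.+1%:R * ('C(m.+1 + n, n)%:R * K ^+ m.+1 * s ^+ n.+1).
  have := mul_bin_left (m + n.+1) n.
  rewrite addnS subSn ?leq_addl// addnK -addSn => e.
  transitivity (K ^+ m.+1 * s ^+ n.+1 * (n.+1 * 'C(m.+1 + n, n.+1))%:R).
    by rewrite natrM; ring.
  by rewrite e natrM; ring.
apply: ler_wpM2l => //.
apply: (le_trans (ler_norm_sum _ _ _)).
have KL0 : K * L != 0 by apply: lt0r_neq0; lra.
have s1 : 1 + K * L != 0 by apply: lt0r_neq0; lra.
apply: (@le_trans _ _ (\sum_(k < n.+1) 'C(m.+1 + n, n)%:R * K ^+ m.+1 * s ^+ n.+1 *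
    (K * L) * (1 + K * L)^-1 ^+ k.+1)); last first.
  rewrite -mulr_sumr -[X in _ <= X]mulr1 -mulrA; apply: ler_wpM2l.
    by rewrite !mulr_ge0// exprn_ge0//; lra.
  rewrite mulrC -ler_pdivlMr ?mul1r; last by lra.
  apply: geometric_sum_le; [by rewrite invr_ge0; lra|by rewrite invr_ge0; lra|].
  rewrite le_eqVlt; apply/orP; left; apply/eqP; field.
  by rewrite s1 andbT; apply/andP; split; apply: lt0r_neq0; lra.
apply: ler_sum => k _.
have kn : (k <= n)%N by rewrite -ltnS.
have nk : (n - k < n.+1)%N by rewrite ltnS leq_subr.
have := IHn _ nk m.+1; have := bG k.+1 y yA.
set a := `|G _ _|; set b := `|comp_coef _ _ _| => ha hb.
have a0 : 0 <= a by exact: normr_ge0.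
have b0 : 0 <= b by exact: normr_ge0.
have -> : `|k.+1%:R * G k.+1 y * comp_coef (n - k) m.+1 y| = k.+1%:R * a * b.
  by rewrite !normrM normr_nat.
apply: (@le_trans _ _ (2 ^+ k.+1 * L ^+ k.+2 *
   (K ^+ m.+2 * 'C(m.+1 + n, n)%:R * s ^+ (n - k)))).
  apply: ler_pM => //; first by rewrite mulr_ge0.
    apply: ler_pM => //; rewrite -natrX ler_nat.
    by apply: ltnW; exact: ltn_expl.
  apply: (le_trans hb); apply: ler_wpM2r; first by rewrite exprn_ge0// ltW.
  apply: ler_wpM2l; first by rewrite exprn_ge0//; lra.
  rewrite ler_nat -(bin_sub (leq_addl m.+1 (n - k))) -(bin_sub (leq_addl m.+1 n)).
  by rewrite !addnK leq_bin2l// leq_add2l leq_subr.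
rewrite le_eqVlt; apply/orP; left; apply/eqP.
have -> : s ^+ n.+1 = s ^+ k.+1 * s ^+ (n - k) by rewrite -exprD addSn subnKC.
have -> : s ^+ k.+1 = 2 ^+ k.+1 * L ^+ k.+1 * (1 + K * L) ^+ k.+1 by rewrite /s !exprMn.
rewrite (exprS L k.+1) (exprS K m.+1) exprVn.
have : (1 + K * L) ^+ k.+1 != 0 by rewrite expf_neq0.
set t := (1 + K * L) ^+ k.+1 => t0; field.
by rewrite ?t0 ?s1.
Qed.

End Composition.

Lemma analytic_comp f g : analytic f -> analytic g -> analytic (f \o g).
Proof.
move=> [H tH <-] [G tG <-]; exists (fun n => comp_coef H G n 0) => //.
split=> [n y|A]; first exact: comp_coef_derive.
have [L L1 bL] := tG.2 A; have [K K1 bK] := tH.2 L.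
have KL1 : 1 <= K * L by exact: mulr_ege1.
have s1 : 1 <= 2 * L * (1 + K * L) by nra.
exists (K * (2 * L * (1 + K * L))) => [|n y yA]; first exact: mulr_ege1.
apply: (le_trans (comp_coef_bound K1 L1 bK bL n 0 yA)).
rewrite add0n binn mulr1 expr1 [X in _ <= X]exprMn.
apply: ler_pM; [lra|by apply: exprn_ge0; lra| |].
  by rewrite -[X in X <= _]expr1; apply: ler_weXn2l.
by apply: ler_weXn2l.
Qed.

(** * The identity theorem on the line *)

Lemma ge0_derive_le f (df : R -> R) a b : a <= b ->
  (forall x : R, is_derive x 1 f (df x)) ->
  (forall x, a <= x <= b -> 0 <= df x) -> f a <= f b.
Proof.
move=> ab dfE df0.
have cf : {within `[a, b], continuous f}.
  apply: continuous_subspaceT => x; apply: differentiable_continuous.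
  by apply/derivable1_diffP; have [] := dfE x.
have [c] := MVT_segment ab (fun x _ => dfE x) cf.
rewrite in_itv /= => /df0 dfc0 e.
by rewrite -subr_ge0 e mulr_ge0// subr_ge0.
Qed.

(** Integration by monotonicity: with p(x) = B (x - c)^(k + 1), both p + f and p - f vanish at c and
    have nonnegative derivative on [c, y]. *)
Lemma power_bound_integrate f (df : R -> R) c y B k : c <= y ->
  (forall x : R, is_derive x 1 f (df x)) -> f c = 0 ->
  (forall x, c <= x <= y -> `|df x| <= B * k.+1%:R * (x - c) ^+ k) ->
  `|f y| <= B * (y - c) ^+ k.+1.
Proof.
move=> cy dfE f0 bdf.
pose p x := B * (x - c) ^+ k.+1.
have dp (x : R) : is_derive x 1 p (B * k.+1%:R * (x - c) ^+ k).
  rewrite (_ : p = B \*: (id - cst c) ^+ k.+1); last first.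
    by apply/funext => z; rewrite /p /= fctE.
  by apply: is_derive_eq; rewrite /GRing.scale /= !fctE subr0 mulr1 mulrA.
have p0 : p c = 0 by rewrite /p subrr exprS mul0r mulr0.
rewrite -/(p y) ler_norml; apply/andP; split.
  have := @ge0_derive_le (f + p) (fun x => df x + B * k.+1%:R * (x - c) ^+ k) c y cy.
  rewrite !fctE f0 p0 addr0 => h; rewrite lerNl -subr_ge0 opprK addrC; apply: h.
  by move=> x /bdf; rewrite ler_norml => /andP[]; lra.
have := @ge0_derive_le (p - f) (fun x => B * k.+1%:R * (x - c) ^+ k - df x) c y cy.
rewrite !fctE f0 p0 subr0 => h; rewrite -subr_ge0; apply: h.
by move=> x /bdf; rewrite ler_norml => /andP[]; lra.
Qed.

(** Taylor remainder estimate: as all coefficients vanish at c, the bound on [T (m + k)] can be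
    integrated k times from c, each integration gaining a factor y - c. *)
Lemma taylor_bound T (A K c : R) :
  (forall n (y : R), is_derive y 1 (T n) (n.+1%:R * T n.+1 y)) ->
  (forall n, T n c = 0) ->
  (forall n y, c <= y <= A -> `|T n y| <= K ^+ n.+1) ->
  forall k m y, c <= y <= A ->
  `|T m y| <= 'C(m + k, k)%:R * K ^+ (m + k).+1 * (y - c) ^+ k.
Proof.
move=> dT Tc bT; elim=> [|k IHk] m y /andP[cy yA].
  by rewrite bin0 addn0 mul1r expr0 mulr1; apply: bT; rewrite cy.
apply: (power_bound_integrate cy (dT m) (Tc m)) => x /andP[cx xy].
rewrite normrM normr_nat.
have /(IHk m.+1) h : c <= x <= A by rewrite cx (le_trans xy).
apply: (le_trans (ler_wpM2l (ler0n _ _) h)).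
rewrite le_eqVlt; apply/orP; left; apply/eqP.
have := mul_bin_left (m + k.+1) k.
rewrite addnS subSn ?leq_addl// addnK -addSn => e.
transitivity ((k.+1 * 'C(m.+1 + k, k.+1))%:R * K ^+ (m.+1 + k).+1 * (x - c) ^+ k).
  by rewrite e natrM; ring.
by rewrite natrM; ring.
Qed.

(** In [taylor_bound] the binomial coefficient is at most 2^(m + k). For y - c <= 1 / (4 K) the
    bound is therefore a constant times 2^(-k), and k tends to infinity. *)
Lemma taylor_zero_step T (A K c y : R) : 1 <= K ->
  (forall n (y : R), is_derive y 1 (T n) (n.+1%:R * T n.+1 y)) ->
  (forall n, T n c = 0) ->
  (forall n y, c <= y <= A -> `|T n y| <= K ^+ n.+1) ->
  c <= y <= A -> y - c <= (4 * K)^-1 -> forall n, T n y = 0.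
Proof.
move=> K1 dT Tc bT cyA yc m; have /andP[cy yA] := cyA.
have bk k : `|T m y| <= 2 ^+ m * K ^+ m.+1 * 2^-1 ^+ k.
  apply: (le_trans (taylor_bound dT Tc bT k m cyA)).
  apply: (@le_trans _ _ (2 ^+ (m + k) * K ^+ (m + k).+1 * (4 * K)^-1 ^+ k)).
    apply: ler_pM; rewrite ?exprn_ge0 ?mulr_ge0 ?exprn_ge0 ?subr_ge0//; try lra.
      apply: ler_wpM2r; first by rewrite exprn_ge0//; lra.
      rewrite -natrX ler_nat -[X in (_ <= X)%N]/((1 + 1) ^ (m + k))%N expnDn.
      have km : (k < (m + k).+1)%N by rewrite ltnS leq_addl.
      by rewrite (bigD1 (Ordinal km)) //= !exp1n !muln1 leq_addr.
    by apply: lerXn2r => //; rewrite nnegrE ?subr_ge0// invr_ge0; lra.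
  rewrite le_eqVlt; apply/orP; left; apply/eqP.
  rewrite -addSn !exprD !exprVn exprMn.
  have -> : 4 = 2 * 2 :> R by ring.
  rewrite exprMn; field.
  by rewrite !expf_neq0//; apply: lt0r_neq0; lra.
apply/eqP; rewrite -normr_le0.
have lim0 : (2 ^+ m * K ^+ m.+1 * 2^-1 ^+ k) @[k --> \oo] --> (0 : R).
  rewrite -[X in _ --> X](mulr0 (2 ^+ m * K ^+ m.+1)); apply: cvgMr.
  by apply: cvg_expr; rewrite ger0_norm; lra.
rewrite -(cvg_lim _ lim0)//; apply: limr_ge; first by apply/cvg_ex; exists 0.
by apply: nearW => k; exact: bk.
Qed.

(** Analytic continuation along the unit segment. One [K] serves all of [-1, 1], so the steps have
    the common length 1 / (4 K) and finitely many of them reach 1. *)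
Lemma analytic_eq0 f (eta : R) : analytic f -> 0 < eta ->
  (forall t : R, 0 < t < eta -> f t = 0) -> f 1 = 0.
Proof.
move=> [T [dT bT] <-] eta0 T0.
(* Where [T n] vanishes on an open interval, so does its derivative, hence [T n.+1]. *)
have Tn0 n (t : R) : 0 < t < eta -> T n t = 0.
  elim: n t => [|n IHn] t teta; first exact: T0.
  have h : is_derive t 1 (T n) (0 : R).
    apply: (near_eq_is_derive (f := cst 0)) => //.
    have : t \in `]0, eta[%R by rewrite in_itv.
    move/near_in_itvoo; apply: filterS => s; rewrite in_itv /= => /IHn ->//.
  have [_ h1] := h; have [_ h2] := dT n t.
  have /eqP : n.+1%:R * T n.+1 t = 0 by rewrite -h2 h1.
  by rewrite mulf_eq0 pnatr_eq0 => /eqP.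
have [K K1 bK] := bT 1.
have [eta2|eta2] := ltP 1 eta; first by apply: T0; rewrite ltr01.
pose d := (4 * K)^-1.
have d0 : 0 < d by rewrite invr_gt0; lra.
(* The march starts at eta / 2, inside the interval of vanishing, and is truncated at 1, where the
   bound by [K] ends. *)
have step j : forall n, T n (Num.min 1 (eta / 2 + j%:R * d)) = 0.
  elim: j => [|j IHj].
    by move=> n; apply: Tn0; rewrite mul0r addr0 min_r; lra.
  set c := Num.min 1 (eta / 2 + j%:R * d) in IHj.
  have jd0 : 0 <= j%:R * d by rewrite mulr_ge0// ltW.
  have c0 : 0 <= c by rewrite le_min; apply/andP; split; lra.
  have cle : c <= Num.min 1 (eta / 2 + j.+1%:R * d).
    by rewrite le_min /c; apply/andP; split; rewrite ge_min ?lexx//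
       -(natr1 j) mulrDl mul1r; apply/orP; right; lra.
  have cle2 : Num.min 1 (eta / 2 + j.+1%:R * d) <= c + d.
    rewrite -(natr1 j) mulrDl mul1r /c; case: (leP 1 (eta / 2 + j%:R * d)) => h.
      by rewrite ge_min; apply/orP; left; lra.
    by rewrite ge_min; apply/orP; right; lra.
  apply: (taylor_zero_step (A := 1) K1 dT IHj).
  - move=> n y /andP[cy y1]; apply: bK.
    by rewrite ger0_norm//; exact: le_trans c0 cy.
  - by rewrite cle ge_min lexx.
  - by rewrite -/d; lra.
have [j hj] : exists j : nat, 1 <= j%:R * d.
  exists (Num.truncn d^-1).+1; rewrite -ler_pdivrMr// mul1r ltW//.
  exact: truncnS_gt.
by have := step j 0%N; rewrite min_l//; lra.
Qed.

End Analytic.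

(** * Analytic independence of networks *)

Section Regular.
Variable R : realType.

Definition continuous_cV n (G : 'cV[R]_n -> R) : Prop :=
  forall (y : 'cV[R]_n) (e : R), 0 < e -> exists2 d : R, 0 < d &
    forall y' : 'cV[R]_n, (forall i, `|y' i 0 - y i 0| < d) -> `|G y' - G y| < e.

(* Composing with curves rather than restricting to lines makes the class
   stable under composition with the layers of a network. *)
Definition regular n (G : 'cV[R]_n -> R) : Prop :=
  continuous_cV G /\
  forall gamma : R -> 'cV[R]_n, (forall i, analytic (fun t => gamma t i 0)) ->
    analytic (fun t => G (gamma t)).

(** Unlike linear independence of the neurons, this notion passes through the composition of layers,
    which is what an induction on the depth requires. *)
Definition analytically_independent m n (F : 'cV[R]_m -> 'cV[R]_n) : Prop :=
  forall G, regular G -> (forall x, G (F x) = 0) -> forall y, G y = 0.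

Lemma fin_common_radius n (P : 'I_n -> R -> Prop) :
  (forall i d d', 0 < d' <= d -> P i d -> P i d') ->
  (forall i, exists2 d, 0 < d & P i d) -> exists2 d, 0 < d & forall i, P i d.
Proof.
move=> mono; elim: n P mono => [|n IHn] P mono ex.
  by exists 1 => // -[].
have [d d0 hd] := IHn (fun i => P (lift ord0 i)) (fun i => @mono _)
  (fun i => ex (lift ord0 i)).
have [d1 d10 hd1] := ex ord0.
have m0 : 0 < Num.min d d1 by rewrite lt_min d0.
exists (Num.min d d1) => // i; have [j ->|->] := unliftP ord0 i.
  by apply: mono (hd j); rewrite m0 ge_min lexx.
by apply: mono hd1; rewrite m0 ge_min lexx orbT.
Qed.

Variable sigma : R -> R.
Hypothesis sigma_an : analytic sigma.

Lemma regular_layer m n (W : 'M[R]_(n, m)) (theta : 'cV[R]_n) G :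
  regular G -> regular (fun y => G (map_mx sigma (W *m y + theta))).
Proof.
move=> [cG aG]; split=> [y e e0|gamma agamma].
  have [d d0 hd] := cG (map_mx sigma (W *m y + theta)) e e0.
  pose P (i : 'I_n) r := forall y' : 'cV[R]_m, (forall k, `|y' k 0 - y k 0| < r) ->
    `|sigma ((W *m y' + theta) i 0) - sigma ((W *m y + theta) i 0)| < d.
  have [r r0 hr] : exists2 r, 0 < r & forall i, P i r.
    apply: fin_common_radius => [i r r' /andP[_ rr'] h y' hy'|i].
      by apply: h => k; apply: lt_le_trans (hy' k) rr'.
    have /cvgrPdist_lt/(_ d d0)[r /= r0 hr] :
        {for (W *m y + theta) i 0, continuous sigma}.
      exact: analytic_continuous.
    pose S := 1 + \sum_k `|W i k|.
    have S0 : 0 < S by rewrite /S ltr_pwDl// sumr_ge0.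
    exists (r / S); first by rewrite divr_gt0.
    move=> y' hy'; rewrite distrC; apply: hr; rewrite /ball_ /= !mxE distrC.
    rewrite opprD addrACA subrr addr0 -sumrB.
    apply: (le_lt_trans (ler_norm_sum _ _ _)).
    apply: (@le_lt_trans _ _ (\sum_k `|W i k| * (r / S))).
      apply: ler_sum => k _; rewrite -mulrBr normrM.
      by apply: ler_wpM2l => //; exact: ltW.
    rewrite -mulr_suml mulrA ltr_pdivrMr// mulrC ltr_pM2l// /S; lra.
  by exists r => // y' hy'; apply: hd => i; rewrite !mxE /=; have := hr i y' hy'; rewrite !mxE.
apply: aG => i.
have -> : (fun t => (map_mx sigma (W *m gamma t + theta)) i 0) =
  sigma \o (fun t => (\sum_k W i k * gamma t k 0) + theta i 0).
  by apply/funext => t; rewrite !mxE.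
apply: analytic_comp => //; apply: analyticD; last exact: analytic_cst.
by apply: analytic_sum => k; exact: analyticZ.
Qed.

Lemma regular_coord n (i : 'I_n) : regular (fun y : 'cV[R]_n => y i 0).
Proof. by split=> [y e e0|gamma h]; [exists e|exact: h]. Qed.

Lemma regularB n (F G : 'cV[R]_n -> R) :
  regular F -> regular G -> regular (fun y => F y - G y).
Proof.
move=> [cF aF] [cG aG]; split=> [y e e0|gamma h].
  have e2 : 0 < e / 2 by lra.
  have [d d0 hd] := cF y _ e2; have [r r0 hr] := cG y _ e2.
  exists (Num.min d r); first by rewrite lt_min d0.
  move=> y' hy'; rewrite opprD addrACA -opprD.
  apply: (le_lt_trans (ler_normB _ _)); rewrite [ltRHS](splitr e).
  by apply: ltrD; [apply: hd|apply: hr] => i;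
    apply: (lt_le_trans (hy' i)); rewrite ge_min lexx ?orbT.
have := analyticD (aF _ h) (analyticZ (-1) (aG _ h)).
by congr analytic; apply/funext => t; rewrite mulN1r.
Qed.

Lemma regular_reindex k n (e : 'I_k -> 'I_n) (G : 'cV[R]_k -> R) :
  regular G -> regular (fun y => G (\col_i y (e i) 0)).
Proof.
move=> [cG aG]; split=> [y r r0|gamma h].
  have [d d0 hd] := cG (\col_i y (e i) 0) r r0.
  by exists d => // y' hy'; apply: hd => i; rewrite !mxE.
by apply: aG => i; have := h (e i); congr analytic; apply/funext => t; rewrite mxE.
Qed.

(** * Merging and comparing clone-free networks *)

Section Networks.
Hypothesis sigma_layer : forall m n (W : 'M[R]_(n, m)) (theta : 'cV[R]_n),
  (forall j, row j W != 0) -> ~ clone_pair W theta ->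
  analytically_independent (fun x => map_mx sigma (W *m x + theta)).

(** The invariant behind independence, preserved by merging and truncation. Nonzero columns come in
    later, in [embeds_support], for the original networks. *)
Fixpoint clone_free m n (N : network R m n) : Prop :=
  match N with
  | Layer _ W theta => (forall j, row j W != 0) /\ ~ clone_pair W theta
  | Snoc _ _ N' W theta =>
      [/\ clone_free N', forall j, row j W != 0 & ~ clone_pair W theta]
  end.

Lemma networks_nc_clone_free m n (N : network R m n) :
  networks_nc R m n N -> clone_free N.
Proof.
case; elim: N => [{}n W th [_ _ [? _]] ?//|k {}n N IHN W th /= [? _ [? _]] nc].
by split=> //; [apply: IHN => //|]; move=> ?; apply: nc; [left|right].
Qed.

(** Induction on the depth: if G vanishes on the outputs, then G composed with the last layer is a
    regular function vanishing on the outputs of the earlier layers. It is then zero everywhere, and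
    the single-layer case gives G = 0. *)
Lemma realize_independent m n (N : network R m n) :
  clone_free N -> analytically_independent (realize sigma N).
Proof.
elim: N => [{}n W th /= [rW cW]|k {}n N IHN W th /= [gN rW cW]].
  exact: sigma_layer.
move=> G rG G0; apply: (sigma_layer rW cW rG) => y.
by apply: (IHN gN (fun y => G (map_mx sigma (W *m y + th)))) => //; exact: regular_layer.
Qed.

Fixpoint depth m n (N : network R m n) : nat :=
  match N with Layer _ _ _ => 1 | Snoc _ _ N' _ _ => (depth N').+1 end.

Lemma depth_gt0 m n (N : network R m n) : (0 < depth N)%N.
Proof. by case: N. Qed.

(* [embeds N M e]: N is the part of M feeding the output neurons [e j]. *)
Fixpoint embeds m n (N : network R m n) K (M : network R m K) :
    ('I_n -> 'I_K) -> Prop :=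
  match N in network _ _ n, M in network _ _ K
    return ('I_n -> 'I_K) -> Prop with
  | Layer _ W th, Layer _ W' th' => fun e =>
      (forall j k, W j k = W' (e j) k) /\ (forall j, th j 0 = th' (e j) 0)
  | Snoc k _ N1 W th, Snoc k' _ M1 W' th' => fun e =>
      exists d : 'I_k -> 'I_k',
        [/\ embeds N1 M1 d, injective d,
            forall j i, W j i = W' (e j) (d i),
            forall j i', (forall i, i' != d i) -> W' (e j) i' = 0 &
            forall j, th j 0 = th' (e j) 0]
  | _, _ => fun _ => False
  end.

Lemma realize_embeds m n (N : network R m n) K (M : network R m K) e x :
  embeds N M e -> forall j, realize sigma N x j 0 = realize sigma M x (e j) 0.
Proof.
elim: N K M e => [{}n W th|k {}n N IHN W th] K [{}K W' th'|k' {}K M W' th'] e //=.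
  move=> [hW hth] j; rewrite !mxE hth; congr (sigma (_ + _)).
  by apply: eq_bigr => i _; rewrite hW.
move=> [d [hN dinj hW hW0 hth]] j; rewrite !mxE hth; congr (sigma (_ + _)).
(* Neurons of [M] outside the range of [d] enter with weight 0; the others are reindexed along
   [d]. *)
rewrite (bigID (fun i' => i' \in codom d)) /= [X in _ = _ + X]big1 ?addr0; last first.
  move=> i' /codomP h; rewrite hW0 ?mul0r// => i.
  by apply/eqP => e0; apply: h; exists i.
rewrite (reindex_omap d (fun i' => [pick i | d i == i'])) /=; last first.
  move=> i' /codomP [i ->]; by case: pickP => [i0 /eqP /= ->|/(_ i)] //; rewrite eqxx.
apply: eq_big => [i|i _]; last by rewrite hW (IHN _ _ _ hN).
rewrite codom_f /=; case: pickP => [i0 /eqP /dinj ->|/(_ i)]; rewrite eqxx//.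
Qed.

(** The pairs (row, bias) of both layers are listed without repetition: a neuron common to both
    becomes a single one, so no clones arise. *)
Lemma merge_rows m n1 n2 (r1 : 'I_n1 -> 'rV[R]_m * R) (r2 : 'I_n2 -> 'rV[R]_m * R) :
  injective r1 -> injective r2 ->
  (forall i, (r1 i).1 != 0) -> (forall i, (r2 i).1 != 0) ->
  exists K (W : 'M[R]_(K, m)) (th : 'cV[R]_K) (e1 : 'I_n1 -> 'I_K) (e2 : 'I_n2 -> 'I_K),
  [/\ (forall j, row j W != 0) /\ ~ clone_pair W th,
      injective e1 /\ injective e2,
      forall i, r1 i = (row (e1 i) W, th (e1 i) 0) &
      forall i, r2 i = (row (e2 i) W, th (e2 i) 0)].
Proof.
move=> inj1 inj2 n01 n02.
pose s := undup (codom r1 ++ codom r2).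
pose W : 'M[R]_(size s, m) := \matrix_(j, k) (nth (0, 0) s j).1 0 k.
pose th : 'cV[R]_(size s) := \col_j (nth (0, 0) s j).2.
have rs (j : 'I_(size s)) : nth (0, 0) s j = (row j W, th j 0).
  rewrite mxE; case e : (nth _ _ _) => [u v] /=; congr (_, _).
  by apply/rowP => k; rewrite !mxE e.
have i1 i : (index (r1 i) s < size s)%N.
  by rewrite index_mem mem_undup mem_cat codom_f.
have i2 i : (index (r2 i) s < size s)%N.
  by rewrite index_mem mem_undup mem_cat codom_f orbT.
pose e1 i := Ordinal (i1 i); pose e2 i := Ordinal (i2 i).
have h1 i : r1 i = (row (e1 i) W, th (e1 i) 0).
  by rewrite -rs /= nth_index// -index_mem.
have h2 i : r2 i = (row (e2 i) W, th (e2 i) 0).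
  by rewrite -rs /= nth_index// -index_mem.
exists (size s), W, th, e1, e2; split=> //.
- split=> [j|[j [j' [jj' eth eW]]]].
    have : nth (0, 0) s j \in s by apply: mem_nth.
    rewrite mem_undup mem_cat rs => /orP[/mapP|/mapP] [i _] /(congr1 fst) /= ->.
      exact: n01.
    exact: n02.
  move/negP: jj'; apply; apply/eqP/val_inj/eqP => /=.
  rewrite -(nth_uniq (0, 0) (ltn_ord j) (ltn_ord j') (undup_uniq _)) !rs eth.
  by apply/eqP; congr (_, _); apply/rowP => k; rewrite !mxE; have := eW k; rewrite !mxE.
- split=> i i' e; [apply: inj1|apply: inj2]; by rewrite ?h1 ?h2 e.
Qed.

Lemma no_clone_inj m n (W : 'M[R]_(n, m)) (th : 'cV[R]_n) j j' :
  ~ clone_pair W th -> (forall k, W j k = W j' k) -> th j 0 = th j' 0 -> j = j'.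
Proof.
by move=> nc eW eth; apply/eqP/negP => jj'; apply: nc; exists j, j'; split=> //; apply/negP.
Qed.

(** Extension by zero of a weight row along [d]; for injective [d] the sum has at most one term. *)
Definition push_row k k' (d : 'I_k -> 'I_k') (w : 'I_k -> R) : 'rV[R]_k' :=
  \row_i' \sum_(i | d i == i') w i.

Lemma push_rowE k k' (d : 'I_k -> 'I_k') w i :
  injective d -> push_row d w 0 (d i) = w i.
Proof.
move=> dinj; rewrite mxE (bigD1 i) //= big1 ?addr0// => i1 /andP[/eqP /dinj ->].
by rewrite eqxx.
Qed.

Lemma push_row_out k k' (d : 'I_k -> 'I_k') w i' :
  (forall i, i' != d i) -> push_row d w 0 i' = 0.
Proof.
by move=> h; rewrite mxE big1// => i /eqP e; have := h i; rewrite e eqxx.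
Qed.

Lemma push_row_neq0 k k' (d : 'I_k -> 'I_k') n (W : 'M[R]_(n, k)) j :
  injective d -> row j W != 0 -> push_row d (W j) != 0.
Proof.
move=> dinj; apply: contraNneq => /rowP e; apply/eqP/rowP => i.
by have := e (d i); rewrite push_rowE// !mxE.
Qed.

(** The earlier layers are merged first. The rows of the two last layers are then transported to the
    merged inputs, where injectivity of [d1] and [d2] keeps distinct neurons distinct, and
    [merge_rows] applies. *)
Lemma merge m n1 (N1 : network R m n1) n2 (N2 : network R m n2) :
  depth N1 = depth N2 -> clone_free N1 -> clone_free N2 ->
  exists K (M : network R m K) e1 e2,
    [/\ clone_free M, embeds N1 M e1, embeds N2 M e2, injective e1 & injective e2].
Proof.
elim: N1 n2 N2 => [{}n1 W1 th1|k1 {}n1 N1 IH W1 th1] n2 [{}n2 W2 th2|k2 {}n2 N2 W2 th2] //=;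
  [|by move=> [e]; have := depth_gt0 N2; rewrite -e
   |by move=> [e]; have := depth_gt0 N1; rewrite e|].
- move=> _ [r1 c1] [r2 c2].
  have [||||K [W [th [e1 [e2 [[rW cW] [i1 i2] h1 h2]]]]]] :=
    @merge_rows m n1 n2 (fun j => (row j W1, th1 j 0)) (fun j => (row j W2, th2 j 0)) => //.
  + move=> j j' [/rowP eW eth]; apply: (no_clone_inj c1) => // k.
    by have := eW k; rewrite !mxE.
  + move=> j j' [/rowP eW eth]; apply: (no_clone_inj c2) => // k.
    by have := eW k; rewrite !mxE.
  exists K, (Layer W th), e1, e2; split=> //=; split=> j.
  + by move=> k; have [/rowP /(_ k)] := h1 j; rewrite !mxE.
  + by have [_ ] := h1 j.
  + by move=> k; have [/rowP /(_ k)] := h2 j; rewrite !mxE.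
  + by have [_ ] := h2 j.
move=> [edepth] [g1 r1 c1] [g2 r2 c2].
have [K' [M [d1 [d2 [gM m1 m2 j1 j2]]]]] := IH _ _ edepth g1 g2.
have [||||K [W [th [e1 [e2 [[rW cW] [i1 i2] h1 h2]]]]]] :=
    @merge_rows K' n1 n2 (fun j => (push_row d1 (W1 j), th1 j 0))
      (fun j => (push_row d2 (W2 j), th2 j 0)).
- move=> j j' [/rowP eW eth]; apply: (no_clone_inj c1) => // k.
  by have := eW (d1 k); rewrite !push_rowE.
- move=> j j' [/rowP eW eth]; apply: (no_clone_inj c2) => // k.
  by have := eW (d2 k); rewrite !push_rowE.
- by move=> j; exact: push_row_neq0.
- by move=> j; exact: push_row_neq0.
exists K, (Snoc M W th), e1, e2; split=> //=.
- exists d1; split=> // j; [move=> i|move=> i' h|]; have [/rowP hW hth] := h1 j => //.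
  + by have := hW (d1 i); rewrite push_rowE// mxE.
  + by have := hW i'; rewrite push_row_out// mxE.
- exists d2; split=> // j; [move=> i|move=> i' h|]; have [/rowP hW hth] := h2 j => //.
  + by have := hW (d2 i); rewrite push_rowE// mxE.
  + by have := hW i'; rewrite push_row_out// mxE.
Qed.

Lemma inj_sub_image_card n1 n2 K (d1 : 'I_n1 -> 'I_K) (d2 : 'I_n2 -> 'I_K) :
  injective d2 -> (forall i, exists i', d2 i = d1 i') -> (n2 <= n1)%N.
Proof.
move=> i2 h; have [f fE] := choice h.
rewrite -(card_ord n1) -(card_ord n2); apply: (leq_card f) => i i' e.
by apply: i2; rewrite !fE e.
Qed.

(** A neuron of the merged network belongs to the copy of the small one exactly when it feeds one of
    the neurons [e j]: a nonzero column means that every neuron of the copy feeds some output. The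
    range of [d] is thus determined by [e] and the weights [W']. *)
Lemma embeds_support k k' n K (W : 'M[R]_(n, k)) (W' : 'M[R]_(K, k'))
    (d : 'I_k -> 'I_k') (e : 'I_n -> 'I_K) i' :
  (forall k, col k W != 0) ->
  (forall j i, W j i = W' (e j) (d i)) ->
  (forall j i', (forall i, i' != d i) -> W' (e j) i' = 0) ->
  (exists j, W' (e j) i' != 0) <-> (exists i, i' = d i).
Proof.
move=> cW hW hW0; split=> [[j] h|[i ->]].
  apply: contrapT => /forallNP ne; move/eqP: h; apply; apply: hW0 => i.
  by apply/eqP; exact: ne.
apply: contrapT => /forallNP ne; move/eqP: (cW i); apply.
apply/colP => j; rewrite !mxE hW; apply/eqP; apply: contrapT => h.
by apply: (ne j); apply/negP.
Qed.

Lemma networkP m n (N : network R m n) :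
  (exists W th, N = Layer W th) \/
  (exists k (N' : network R m k) W th, N = Snoc N' W th).
Proof.
by case: N => [{}n W th|k {}n N W th]; [left; exists W, th|right; exists k, N, W, th].
Qed.

(** Copies sharing their output neurons share their hidden neurons, layer by layer from the last one
    down, so each hidden permutation is read off from d2 = d1 o h. *)
Lemma embeds_iso m K (M : network R m K) n (N1 N2 : network R m n)
    (e1 e2 : 'I_n -> 'I_K) (g : {perm 'I_n}) :
  embeds N1 M e1 -> embeds N2 M e2 -> network_axioms N1 -> network_axioms N2 ->
  (forall j, e2 j = e1 (g j)) -> iso_rel g N1 N2.
Proof.
elim: N1 K M e1 g N2 e2 => [{}n W1 th1|k1 {}n N1 IH W1 th1] K
    [{}K W th|k {}K M W th] e1 g N2 e2 //=.
  move=> [hW1 hth1]; have [[W2 [th2 ->]]|[k2 [N2' [W2 [th2 ->]]]]] := networkP N2 => //=.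
  move=> [hW2 hth2] _ _ e12.
  by apply: iso_Layer => j => [i|]; rewrite ?hW2 ?hth2 e12 ?hW1 ?hth1.
move=> [d1 [m1 i1 hW1 hW01 hth1]].
have [[W2 [th2 ->]]|[k2 [N2' [W2 [th2 ->]]]]] := networkP N2 => //=.
move=> [d2 [m2 i2 hW2 hW02 hth2]] [a1 _ [_ c1]] [a2 _ [_ c2]] e12.
(* Both ranges are the set of neurons of [M] feeding the common output neurons. *)
have im i' : (exists i, i' = d1 i) <-> (exists i, i' = d2 i).
  rewrite -(embeds_support (e := e1) i' c1 hW1 hW01).
  rewrite -(embeds_support (e := e2) i' c2 hW2 hW02).
  split=> [[j]|[j]]; last by rewrite e12; exists (g j).
  have [f _ fK] := injF_bij (@perm_inj _ g).
  by exists (f j); rewrite e12 fK.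
have ex2 i : exists i', d2 i = d1 i' by apply/im; exists i.
have ex1 i : exists i', d1 i = d2 i' by apply/im; exists i.
have ek : k2 = k1.
  by apply/eqP; rewrite eqn_leq (inj_sub_image_card i2 ex2) (inj_sub_image_card i1 ex1).
move: ek => ek; subst k2.
have [h hE] := choice ex2.
have hinj : injective h by move=> i i' e; apply: i2; rewrite !hE e.
apply: (iso_Snoc (h := perm hinj)).
- by apply: (IH _ _ _ _ _ _ m1 m2) => // j; rewrite permE.
- by move=> j i; rewrite hW2 hW1 e12 permE hE.
- by move=> j; rewrite hth2 e12 hth1.
Qed.

Variable B : R.
Hypothesis sigma_bounded : forall x, `|sigma x| <= B.

(** The network is cut after [d] layers. The remaining map [F] consists of at least one layer: it
    preserves regularity under composition, and it is bounded because it ends with [sigma]. *)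
Lemma realize_prefix m n (N : network R m n) d : clone_free N ->
  (0 < d < depth N)%N ->
  exists k (N' : network R m k) (F : 'cV[R]_k -> 'cV[R]_n),
  [/\ clone_free N', depth N' = d, forall x, realize sigma N x = F (realize sigma N' x),
      forall G, regular G -> regular (fun y => G (F y)) & forall y i, `|F y i 0| <= B].
Proof.
elim: N => [{}n W th _|k {}n N IHN W th /= [gN rW cW]]; first by case: d => [|[]].
move=> /andP[d0]; rewrite ltnS leq_eqVlt => /orP[/eqP ->|dN].
  exists k, N, (fun y => map_mx sigma (W *m y + th)); split=> //.
    by move=> G; exact: regular_layer.
  by move=> y i; rewrite !mxE.
have [|k' [N' [F [gN' dN' hF rF bF]]]] := IHN gN; first by rewrite d0.
exists k', N', (fun y => map_mx sigma (W *m F y + th)); split=> //.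
- by move=> x; rewrite hF.
- by move=> G /(regular_layer W th) /rF.
- by move=> y i; rewrite !mxE.
Qed.

(** If [N2] were deeper, its prefix of the depth of [N1] could be merged with [N1]. An output of
    [N1] is then a bounded function of the outputs of the prefix; by independence this relation
    extends to all vectors, although a coordinate is unbounded. *)
Lemma realize_depth_eq m n (N1 N2 : network R m n) : (0 < n)%N ->
  clone_free N1 -> clone_free N2 ->
  (forall x, realize sigma N1 x = realize sigma N2 x) -> (depth N2 <= depth N1)%N.
Proof.
move=> n0 g1 g2 eN; rewrite leqNgt; apply/negP => lt12.
have [|k [N' [F [gN' dN' hF rF bF]]]] := realize_prefix (d := depth N1) g2.
  by rewrite depth_gt0.
have [K [M [e1 [e2 [gM m1 m2 _ _]]]]] := merge (esym dN') g1 gN'.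
pose i0 := Ordinal n0.
pose G (y : 'cV[R]_K) := y (e1 i0) 0 - F (\col_i y (e2 i) 0) i0 0.
have rG : regular G.
  apply: regularB; first exact: regular_coord.
  exact: (regular_reindex e2 (rF _ (regular_coord i0))).
have G0 x : G (realize sigma M x) = 0.
  rewrite /G -(realize_embeds x m1) eN hF; apply/eqP; rewrite subr_eq0.
  apply/eqP; congr (F _ _ _); apply/colP => i.
  by rewrite mxE (realize_embeds x m2).
(* The coordinate takes the value 1 + |B| here, which exceeds the bound B on [F]. *)
have /eqP := realize_independent gM rG G0 (const_mx (1 + `|B|)).
rewrite /G subr_eq0 mxE => /eqP e.
have := bF (\col_i (const_mx (1 + `|B|) : 'cV[R]_K) (e2 i) 0) i0; rewrite -e.
have := ler_norm B; have := ler_norm (1 + `|B|); lra.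
Qed.

Lemma networks_nc_identifiable m n :
  identifiable (networks_nc R m n) sigma (@isomorphic R m n).
Proof.
move=> N1 N2 S1 S2 eN.
have g1 := networks_nc_clone_free S1; have g2 := networks_nc_clone_free S2.
have n0 : (0 < n)%N by case: S1 => + _; case: (N1) => [? ? ?|? ? ? ? ?] /= [].
have ed : depth N1 = depth N2.
  by apply/eqP; rewrite eqn_leq !realize_depth_eq.
have [K [M [e1 [e2 [gM m1 m2 i1 i2]]]]] := merge ed g1 g2.
apply: (embeds_iso m1 m2 S1.1 S2.1) => j; rewrite perm1.
pose G (y : 'cV[R]_K) := y (e2 j) 0 - y (e1 j) 0.
have rG : regular G by apply: regularB; exact: regular_coord.
have G0 x : G (realize sigma M x) = 0.
  by rewrite /G -(realize_embeds x m1) -(realize_embeds x m2) eN subrr.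
(* The unit vector at [e1 j] separates this coordinate from every other one. *)
have := realize_independent gM rG G0 (delta_mx (e1 j) 0).
rewrite /G !mxE !eqxx /= andbT; case: eqP => [->//|_] /eqP.
by rewrite sub0r oppr_eq0 oner_eq0.
Qed.

End Networks.
End Regular.

(** * Independence of an oscillating layer *)

Section Oscillation.
Variable R : realType.

Lemma sin_lipschitz (x y : R) : x <= y -> `|sin y - sin x| <= y - x.
Proof.
move=> xy.
have d (s z : R) : is_derive z 1 (id + s \*: @sin R) (1 + s * cos z).
  by apply: is_derive_eq.
have c1 z := cos_le1 (z : R); have cN1 z := cos_geN1 (z : R).
have h1 := @ge0_derive_le R _ _ x y xy (d 1) _.
have h2 := @ge0_derive_le R _ _ x y xy (d (-1)) _.
rewrite ler_norml; apply/andP; split.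
  have : (id + 1 \*: @sin R) x <= (id + 1 \*: @sin R) y.
    by apply: h1 => z _; have := cN1 z; lra.
  by rewrite !fctE /= /GRing.scale /=; lra.
have : (id + (-1) \*: @sin R) x <= (id + (-1) \*: @sin R) y.
  by apply: h2 => z _; have := c1 z; lra.
by rewrite !fctE /= /GRing.scale /=; lra.
Qed.

(** Within 2 pi above phi(u) the phase meets a translate beta of alpha by a multiple of 2 pi; the
    window is where the phase runs from beta to beta + e, and the sine is 1-Lipschitz. The exact
    increment e is recorded because the next, faster phase is compared with it. *)
Lemma phase_window (phi : R -> R) u v alpha e : continuous phi -> u <= v ->
  {in `[u, v]%R &, {homo phi : s t / s <= t}} ->
  phi u + 4 * pi <= phi v -> alpha <= phi u -> 0 < e <= 1 ->
  exists u' v', [/\ u <= u' <= v', v' <= v, phi v' = phi u' + e &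
    forall t, u' <= t <= v' -> `|sin (phi t) - sin alpha| <= e].
Proof.
move=> cphi uv mono amp au /andP[e0 e1].
have pi1 : 2 <= pi :> R by exact: pi_ge2.
pose x := (phi u - alpha) / (2 * pi).
have x0 : 0 <= x by rewrite divr_ge0//; lra.
pose k := (Num.truncn x).+1.
have /andP[k1 k2] := truncn_itv x0.
have xE : x * (2 * pi) = phi u - alpha by rewrite divfK//; apply: lt0r_neq0; lra.
have kE : k%:R = (Num.truncn x)%:R + 1 :> R by rewrite natr1.
pose beta := alpha + (pi *+ 2) *+ k.
have betaE : beta = alpha + k%:R * (2 * pi).
  by rewrite /beta -[pi *+ 2]mulr_natl -[_ *+ k]mulr_natl.
have pi20 : 0 <= 2 * pi :> R by lra.
have k3 : x * (2 * pi) <= k%:R * (2 * pi) by rewrite ler_wpM2r// ltW.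
have k4 : k%:R * (2 * pi) <= (x + 1) * (2 * pi).
  by rewrite ler_wpM2r// kE lerD2r.
rewrite (mulrDl x 1) mul1r xE in k4; rewrite xE in k3.
have b1 : phi u <= beta by rewrite betaE; lra.
have b2 : beta <= phi u + 2 * pi by rewrite betaE; lra.
have cw a b : {within `[a, b], continuous phi} by exact: continuous_subspaceT.
have puv : phi u <= phi v by lra.
have [|u'] := @IVT R phi u v beta uv (cw u v).
  by rewrite min_l ?max_r//; apply/andP; split; lra.
rewrite in_itv /= => /andP[uu' u'v] u'E.
have puv' : phi u' <= phi v by lra.
have [|v'] := @IVT R phi u' v (beta + e) u'v (cw u' v).
  by rewrite min_l ?max_r//; apply/andP; split; lra.
rewrite in_itv /= => /andP[u'v' v'v] v'E.
exists u', v'; split=> //; first by rewrite uu'.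
  by rewrite v'E u'E.
move=> t /andP[u't tv'].
have pt1 : phi u' <= phi t by apply: mono; rewrite ?in_itv/= //; apply/andP; split; lra.
have pt2 : phi t <= phi v' by apply: mono; rewrite ?in_itv/= //; apply/andP; split; lra.
have -> : sin alpha = sin beta by rewrite /beta (periodicn (@sinD2pi R)).
rewrite -u'E; apply: (le_trans (sin_lipschitz pt1)); lra.
Qed.

(** Increments are compared instead of values: over a window on which [f] moves by a fixed small
    amount, [g] must sweep several periods. *)
Definition dominates (f g : R -> R) := forall M, 0 <= M -> exists S,
  forall s t, S <= s <= t -> M * (f t - f s) <= g t - g s.

(** Nested windows, from the slowest phase to the fastest: inside the window chosen for one phase,
    the next phase still covers an amplitude of 4 pi, and [phase_window] applies again. *)
Lemma phases_dense (I : eqType) (phi : I -> R -> R) (alpha : I -> R) (e : R) i s :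
  (forall i, continuous (phi i)) -> (forall i t, alpha i <= phi i t) ->
  (forall i, exists S, forall s t, S <= s <= t -> phi i s <= phi i t) ->
  0 < e <= 1 -> path (fun i j => `[< dominates (phi i) (phi j) >]) i s ->
  exists S, forall u v, S <= u <= v -> phi i u + 4 * pi <= phi i v ->
    exists2 t, u <= t <= v &
      forall j, j \in i :: s -> `|sin (phi j t) - sin (alpha j)| <= e.
Proof.
move=> cphi aphi mono e01; have /andP[e0 e1] := e01.
have pi1 : 2 <= pi :> R by exact: pi_ge2.
have win j S u v : (forall s t, S <= s <= t -> phi j s <= phi j t) ->
    S <= u <= v -> phi j u + 4 * pi <= phi j v ->
    exists u' v', [/\ u <= u' <= v', v' <= v, phi j v' = phi j u' + e &
    forall t, u' <= t <= v' -> `|sin (phi j t) - sin (alpha j)| <= e].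
  move=> hS /andP[Su uv] amp; apply: phase_window => //.
  move=> a b; rewrite !in_itv /= => /andP[ua _] _ ab; apply: hS.
  by rewrite ab andbT; exact: le_trans ua.
elim: s i => [|j s IHs] i /=.
  move=> _; have [S hS] := mono i; exists S => u v uv amp.
  have [u' [v' [/andP[uu' u'v'] v'v _ h]]] := win _ _ _ _ hS uv amp.
  exists u'; first by rewrite uu' (le_trans u'v').
  by move=> k; rewrite inE => /eqP ->; apply: h; rewrite lexx.
move=> /andP[/asboolP dom /IHs [S1 hS1]].
have [S2 hS2] := mono i.
(* The current phase moves by e on its window, so this factor makes the next one move by at least 4
   pi. *)
have [|S3 hS3] := dom (4 * pi / e); first by rewrite divr_ge0//; lra.
exists (Num.max S1 (Num.max S2 S3)) => u v /andP[]; rewrite !ge_max.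
move=> /and3P[S1u S2u S3u] uv amp.
have [||u' [v' [/andP[uu' u'v'] v'v ev h]]] := win i S2 u v hS2; rewrite ?S2u//.
have [||t /andP[u't tv'] ht] := hS1 u' v'.
- by rewrite u'v' andbT; lra.
- have /hS3 : S3 <= u' <= v' by rewrite u'v' andbT; lra.
  rewrite ev addrAC subrr add0r divfK; last by apply: lt0r_neq0.
  lra.
exists t; first by apply/andP; split; lra.
move=> k; rewrite inE => /orP[/eqP ->|]; last exact: ht.
by apply: h; rewrite u't.
Qed.

Lemma linear_growth (f : R -> R) (p : {poly R}) :
  (forall t : R, is_derive t 1 f p.[t]) -> 0 < lead_coef p ->
  exists c S, 0 < c /\ forall s t, S <= s <= t -> c * (t - s) <= f t - f s.
Proof.
move=> df lp; have [S hS] := poly_pinfty_gt_lc lp.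
exists (lead_coef p), S; split=> // s t /andP[Ss st].
have d z : is_derive (z : R) 1 (f - lead_coef p \*: id) (p.[z] - lead_coef p).
  have ? := df z; apply: is_derive_eq.
  by rewrite /GRing.scale /= mulr1.
have := @ge0_derive_le R _ _ s t st d.
rewrite !fctE /= /GRing.scale /= => h.
rewrite mulrBr; suff : f s - lead_coef p * s <= f t - lead_coef p * t by lra.
by apply: h => z /andP[sz _]; rewrite subr_ge0; apply: hS; exact: le_trans sz.
Qed.

(** * Phases and their orders of growth *)

Definition phase_exponent (a b t : R) : R := (a * t + b) ^+ 4 + (a * t + b).

Definition phase_exponent_deriv (a b : R) : {poly R} :=
  a *: (4 *: (a *: 'X + b%:P) ^+ 3 + 1).

Lemma phase_exponent_derivE a b t : (phase_exponent_deriv a b).[t] =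
  a * (4 * (a * t + b) ^+ 3 + 1).
Proof. by rewrite /phase_exponent_deriv !hornerE. Qed.

Lemma is_derive_phase_exponent a b (t : R) :
  is_derive t 1 (phase_exponent a b) (phase_exponent_deriv a b).[t].
Proof.
rewrite phase_exponent_derivE.
have h : is_derive t 1 (a \*: id + cst b) a.
  by apply: is_derive_eq; rewrite /GRing.scale /= mulr1 addr0.
rewrite (_ : phase_exponent a b = (a \*: id + cst b) ^+ 4 + (a \*: id + cst b)); last first.
  by apply/funext => z; rewrite /phase_exponent !fctE.
apply: (is_derive_eq (is_deriveD (is_deriveX 4 h) h)).
by rewrite /GRing.scale /= !fctE /= mulrDr mulr1 mulrC.
Qed.

(* The term [x] in the exponent [x ^+ 4 + x] is what tells (a, b) from
   (- a, - b). *)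
Lemma phase_exponent_deriv_inj a b a' b' : a != 0 ->
  phase_exponent_deriv a b = phase_exponent_deriv a' b' -> (a, b) = (a', b').
Proof.
move=> a0 e.
have E t : a * (4 * (a * t + b) ^+ 3 + 1) = a' * (4 * (a' * t + b') ^+ 3 + 1).
  by rewrite -!phase_exponent_derivE e.
have E0 := E 0; have E1 := E 1; have E2 := E (-1); have E3 := E 2.
(* Third differences isolate a^4; second differences then isolate a^3 b. *)
have c4 : a ^+ 4 = a' ^+ 4.
  suff : 4 * 6 * (a ^+ 4 - a' ^+ 4) = 0 by lra.
  have -> : 4 * 6 * (a ^+ 4 - a' ^+ 4) =
    (a * (4 * (a * 2 + b) ^+ 3 + 1) - a' * (4 * (a' * 2 + b') ^+ 3 + 1))
    - 3 * (a * (4 * (a * 1 + b) ^+ 3 + 1) - a' * (4 * (a' * 1 + b') ^+ 3 + 1))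
    + 3 * (a * (4 * (a * 0 + b) ^+ 3 + 1) - a' * (4 * (a' * 0 + b') ^+ 3 + 1))
    - (a * (4 * (a * -1 + b) ^+ 3 + 1) - a' * (4 * (a' * -1 + b') ^+ 3 + 1)) by ring.
  by rewrite E0 E1 E2 E3; ring.
have c3 : a ^+ 3 * b = a' ^+ 3 * b'.
  suff : 24 * (a ^+ 3 * b - a' ^+ 3 * b') = 0 by lra.
  have -> : 24 * (a ^+ 3 * b - a' ^+ 3 * b') =
    (a * (4 * (a * 1 + b) ^+ 3 + 1) - a' * (4 * (a' * 1 + b') ^+ 3 + 1))
    - 2 * (a * (4 * (a * 0 + b) ^+ 3 + 1) - a' * (4 * (a' * 0 + b') ^+ 3 + 1))
    + (a * (4 * (a * -1 + b) ^+ 3 + 1) - a' * (4 * (a' * -1 + b') ^+ 3 + 1)) by ring.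
  by rewrite E0 E1 E2; ring.
have a30 : a ^+ 3 != 0 by rewrite expf_neq0.
have : (a ^+ 2 - a' ^+ 2) * (a ^+ 2 + a' ^+ 2) = 0.
  by rewrite -subr_sqr -!exprM c4 subrr.
move/eqP; rewrite mulf_eq0 => /orP[|]; last first.
  rewrite paddr_eq0 ?sqr_ge0// => /andP[]; rewrite sqrf_eq0 => /eqP a00.
  by rewrite a00 eqxx in a0.
rewrite subr_eq0 eqf_sqr => /orP[/eqP aa'|/eqP aa'].
  congr (_, _) => //; apply: (mulfI a30); rewrite c3 aa'//.
(* In the case a = - a', also b = - b', and the values at t = 0 force a = 0. *)
have bb' : b = - b'.
  by apply: (mulfI a30); rewrite c3 aa'; ring.
have : 2 * a = 0 by move: E0; rewrite bb' aa'; lra.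
by move/eqP; rewrite mulf_eq0 (negbTE a0) pnatr_eq0.
Qed.

(** The leading coefficient is 4 a^4, so each phase grows as t tends to +oo whatever the sign of
    a. *)
Lemma lead_coef_phase_exponent_deriv a b : a != 0 ->
  0 < lead_coef (phase_exponent_deriv a b).
Proof.
move=> a0; rewrite /phase_exponent_deriv lead_coefZ.
have s2 : size (a *: 'X + b%:P) = 2%N.
  by rewrite size_polyDl size_scale// ?size_polyX// size_polyC; case: eqP.
have s4 : size (4 *: (a *: 'X + b%:P) ^+ 3) = 4%N.
  rewrite size_scale ?pnatr_eq0//; have := size_exp (a *: 'X + b%:P) 3.
  by rewrite s2; case: (size _) => //= k ->.
rewrite lead_coefDl; last by rewrite s4 size_poly1.
rewrite lead_coefZ lead_coef_exp.
rewrite lead_coefDl; last by rewrite size_scale// size_polyX size_polyC; case: eqP.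
rewrite lead_coefZ lead_coefX mulr1.
have -> : a * (4 * a ^+ 3) = 4 * (a ^+ 2) ^+ 2 by ring.
by rewrite mulr_gt0// exprn_even_gt0//= sqrf_eq0.
Qed.

Definition phase (a b t : R) : R := expR (phase_exponent a b t).

Lemma phase_continuous a b : continuous (phase a b).
Proof.
move=> t; apply: differentiable_continuous; apply/derivable1_diffP.
have h := is_derive_phase_exponent a b t.
by rewrite (_ : phase a b = expR \o phase_exponent a b).
Qed.

Lemma phase_nondecreasing a b : a != 0 ->
  exists S, forall s t, S <= s <= t -> phase a b s <= phase a b t.
Proof.
move=> a0.
have [c [S [c0 hS]]] := linear_growth (is_derive_phase_exponent a b)
  (lead_coef_phase_exponent_deriv b a0).
exists S => s t st; rewrite ler_expR -subr_ge0; apply: le_trans (hS _ _ st).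
by have /andP[_ ?] := st; rewrite mulr_ge0 ?subr_ge0// ltW.
Qed.

Lemma phase_unbounded a b u M : a != 0 -> exists2 v, u <= v & M <= phase a b v.
Proof.
move=> a0.
have [c [S [c0 hS]]] := linear_growth (is_derive_phase_exponent a b)
  (lead_coef_phase_exponent_deriv b a0).
set u1 := Num.max u S.
set D := `|M - phase_exponent a b u1|.
have D00 : 0 <= D by exact: normr_ge0.
have D0 : 0 <= D / c by rewrite divr_ge0// ltW.
exists (u1 + D / c).
  by apply: (@le_trans _ _ u1); [rewrite le_max lexx|lra].
have /hS : S <= u1 <= u1 + D / c by rewrite le_max lexx orbT /=; lra.
rewrite (addrC u1) addrK mulrC divfK ?gt_eqF// => h.
have := expR_ge1Dx (phase_exponent a b (D / c + u1)).
have := ler_norm (M - phase_exponent a b u1); rewrite -/D /phase; lra.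
Qed.

(** The second phase is the first one times exp D, where D is the difference of the exponents. D is
    eventually nondecreasing and at least M, so increments are multiplied by at least M. *)
Lemma phase_dominates a b a' b' : a != 0 ->
  0 < lead_coef (phase_exponent_deriv a' b' - phase_exponent_deriv a b) ->
  dominates (phase a b) (phase a' b').
Proof.
move=> a0 lc M M0.
have [S1 hS1] := phase_nondecreasing b a0.
have dD (t : R) : is_derive t 1 (phase_exponent a' b' - phase_exponent a b)
    (phase_exponent_deriv a' b' - phase_exponent_deriv a b).[t].
  have ? := is_derive_phase_exponent a b t.
  have ? := is_derive_phase_exponent a' b' t.
  by apply: is_derive_eq; rewrite hornerD hornerN.
have [c [S2 [c0 hS2]]] := linear_growth dD lc.
set D := phase_exponent a' b' - phase_exponent a b in hS2.
pose S := Num.max S1 (S2 + `|M - D S2| / c).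
have K0 : 0 <= `|M - D S2| / c by rewrite divr_ge0// ltW.
exists S => s t /andP[]; rewrite /S ge_max => /andP[S1s S2s] st.
have phE z : phase a' b' z = phase a b z * expR (D z).
  by rewrite /phase -expRD /D !fctE; congr expR; lra.
have DM : M <= D s.
  have /hS2 : S2 <= S2 <= s by rewrite lexx /=; lra.
  have : `|M - D S2| <= c * (s - S2).
    by rewrite mulrC -ler_pdivrMr//; lra.
  by have := ler_norm (M - D S2); lra.
have Dst : D s <= D t.
  have /hS2 : S2 <= s <= t by rewrite st andbT; lra.
  have : 0 <= c * (t - s) by rewrite mulr_ge0 ?subr_ge0// ltW.
  lra.
have ph : phase a b s <= phase a b t by apply: hS1; rewrite S1s.
have p0 : 0 <= phase a b t by exact: expR_ge0.
rewrite !phE; have := expR_ge1Dx (D s).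
have : expR (D s) <= expR (D t) by rewrite ler_expR.
move: (expR (D s)) (expR (D t)) => x y xy xD; nra.
Qed.

Lemma sorted_uniq_strict (T : eqType) (leT ltT : rel T) x s :
  (forall i j, i != j -> leT i j -> ltT i j) ->
  uniq (x :: s) -> path leT x s -> path ltT x s.
Proof.
move=> h; elim: s x => //= y s IHs x; rewrite inE negb_or => /andP[/andP[xy _] us].
by move=> /andP[lxy ps]; rewrite h//= IHs.
Qed.

Lemma sin_phases_dense n (a b : 'I_n -> R) (z : 'I_n -> R) (e S0 : R) :
  (forall j, a j != 0) -> (forall j j', (a j, b j) = (a j', b j') -> j = j') ->
  (forall j, `|z j| <= 1) -> 0 < e ->
  exists2 t, S0 <= t & forall j, `|sin (phase (a j) (b j) t) - z j| <= e.
Proof.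
move=> a0 inj z1 e0.
have pi1 : 2 <= pi :> R by exact: pi_ge2.
pose dq j := phase_exponent_deriv (a j) (b j).
(* Neurons are sorted by growth of their phases. The order is strict between distinct neurons
   because their derivative polynomials differ. *)
pose leT : rel 'I_n := fun i j => 0 <= lead_coef (dq j - dq i).
have totT : total leT.
  move=> i j; rewrite /leT.
  have -> : lead_coef (dq i - dq j) = - lead_coef (dq j - dq i).
    by rewrite -lead_coefN opprB.
  by rewrite oppr_ge0; exact: le_total.
pose e' := Num.min e 1.
have e'01 : 0 < e' <= 1 by rewrite lt_min e0 ltr01 ge_min lexx orbT.
case es : (sort leT (enum 'I_n)) => [|i s].
  exists S0 => // j; have : j \in sort leT (enum 'I_n) by rewrite mem_sort mem_enum.
  by rewrite es.
have ps : path (fun i j => `[< dominates (phase (a i) (b i)) (phase (a j) (b j)) >]) i s.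
  apply: (@sorted_uniq_strict _ leT).
  - move=> i1 j ij; rewrite /leT le_eqVlt eq_sym lead_coef_eq0 subr_eq0 => /orP[/eqP h|lc].
      by move: ij; rewrite (inj _ _ (phase_exponent_deriv_inj (a0 j) h)) eqxx.
    by apply/asboolP; exact: phase_dominates.
  - by rewrite -es sort_uniq enum_uniq.
  - by have := sort_sorted totT (enum 'I_n); rewrite es.
(* Subtracting a period makes the target angle negative, hence below every value of the phase. *)
pose alpha j := asin (z j) - pi *+ 2.
have z11 j : -1 <= z j <= 1 by rewrite -ler_norml.
have sa j : sin (alpha j) = z j.
  have := @sinD2pi R (alpha j); rewrite /alpha subrK => <-.
  by rewrite asinK// in_itv /=.
have [|||S hS] := @phases_dense _ (fun j => phase (a j) (b j)) alpha e' i s _ _ _ e'01 ps.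
- by move=> j; exact: phase_continuous.
- move=> j t; apply: (@le_trans _ _ 0); last exact: expR_ge0.
  by rewrite /alpha mulr2n; have := asin_lepi2 (z11 j); lra.
- by move=> j; exact: phase_nondecreasing.
pose u := Num.max S S0.
have [v uv hv] := phase_unbounded (b i) u (phase (a i) (b i) u + 4 * pi) (a0 i).
have [||t /andP[ut tv] ht] := hS u v => //.
  by rewrite uv andbT le_max lexx.
exists t; first by apply: le_trans ut; rewrite le_max lexx orbT.
move=> j; rewrite -sa; apply: (@le_trans _ _ e'); last by rewrite ge_min lexx.
by apply: ht; rewrite -es mem_sort mem_enum.
Qed.

(** On the moment curve v = (1, x, x^2, ...) the product w v is a polynomial in x with the entries
    of w as coefficients, so a large x avoids the roots of all of them. *)
Lemma generic_direction m (s : seq 'rV[R]_m) : all (fun w => w != 0) s ->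
  exists v : 'cV[R]_m, forall w, w \in s -> (w *m v) 0 0 != 0.
Proof.
move=> s0; pose p := \prod_(w <- s) rVpoly w.
have p0 : p != 0.
  rewrite prodf_seq_neq0; apply: sub_all s0 => w /=; apply: contraNneq => e.
  by rewrite -(rVpolyK w) e linear0.
(* Squaring makes the leading coefficient positive, hence the value positive at large x. *)
have : 0 < lead_coef (p ^+ 2).
  by rewrite lead_coef_exp exprn_even_gt0//= lead_coef_eq0.
move=> lp; have [x hx] := poly_pinfty_gt_lc lp.
have px : p.[x] != 0.
  have := lt_le_trans lp (hx x (lexx x)); rewrite horner_exp.
  by apply: contraTneq => ->; rewrite expr0n /= ltxx.
exists (\col_i x ^+ i) => w ws.
have : (rVpoly w).[x] != 0.
  move: px; rewrite /p (big_rem w ws) /= hornerM mulf_eq0 negb_or.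
  by case/andP.
congr (_ != _); rewrite mxE (horner_coef_wide _ (size_poly _ _)).
by apply: eq_bigr => i _; rewrite coef_rVpoly_ord mxE.
Qed.

(** * Independence of one clone-free layer *)

Variables (p : R -> R) (delta cp cm : R).
Hypothesis delta0 : 0 < delta.
Hypothesis p_pinfty : forall e : R, 0 < e -> exists X, forall x, X <= x -> `|p x - cp| < e.
Hypothesis p_ninfty : forall e : R, 0 < e -> exists X, forall x, x <= X -> `|p x - cm| < e.

Let sigma x := p x + delta * sin (expR (x ^+ 4 + x)).

Lemma p_lim_affine a b : a != 0 -> forall e, 0 < e -> exists X, forall t, X <= t ->
  `|p (a * t + b) - (if 0 < a then cp else cm)| < e.
Proof.
move=> a0 e e0; case: ifPn => [a1|].
  have [X hX] := p_pinfty e0; exists ((X - b) / a) => t.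
  by rewrite ler_pdivrMr// => h; apply: hX; lra.
rewrite -leNgt le_eqVlt (negbTE a0) /= => a1.
have [X hX] := p_ninfty e0; exists ((X - b) / a) => t.
by rewrite ler_ndivrMr// => h; apply: hX; lra.
Qed.

(** Along a generic line the terms [p] converge to the coordinates of c while the sines come close
    to any prescribed values. By continuity G vanishes on the box of half-width delta around c, and
    by [analytic_eq0] on every line through c. *)
Lemma oscillating_layer_independent m n (W : 'M[R]_(n, m)) (theta : 'cV[R]_n) :
  (forall j, row j W != 0) -> ~ clone_pair W theta ->
  analytically_independent (fun x => map_mx sigma (W *m x + theta)).
Proof.
move=> rW cW G [cG aG] G0.
(* The direction must keep every row nonzero and distinct rows distinct; neurons with equal rows
   have different biases. *)
pose s := [seq row j W | j <- enum 'I_n] ++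
  [seq row ij.1 W - row ij.2 W | ij <- enum {: 'I_n * 'I_n} & row ij.1 W != row ij.2 W].
have [v hv] : exists v : 'cV[R]_m, forall w, w \in s -> (w *m v) 0 0 != 0.
  apply: generic_direction; rewrite all_cat; apply/andP; split.
    by apply/allP => w /mapP[j _ ->].
  apply/allP => w /mapP[ij]; rewrite mem_filter => /andP[h _] ->.
  by rewrite subr_eq0.
pose a j := (W *m v) j 0.
have rowv j : (row j W *m v) 0 0 = a j by rewrite -row_mul mxE.
have a0 j : a j != 0.
  rewrite -rowv; apply: hv; rewrite mem_cat; apply/orP; left.
  by apply/mapP; exists j; rewrite ?mem_enum.
have inj j j' : (a j, theta j 0) = (a j', theta j' 0) -> j = j'.
  move=> [eaj eth]; apply: (no_clone_inj cW) => // k.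
  have [/rowP/(_ k)|ne] := eqVneq (row j W) (row j' W); first by rewrite !mxE.
  suff : a j - a j' != 0 by rewrite eaj subrr eqxx.
  have -> : a j - a j' = ((row j W - row j' W) *m v) 0 0.
    by rewrite mulmxBl mxE [X in _ = _ + X]mxE !rowv.
  apply: hv; rewrite mem_cat; apply/orP; right.
  by apply/mapP; exists (j, j') => //; rewrite mem_filter /= ne mem_enum.
have layE t j : (W *m (t *: v) + theta) j 0 = a j * t + theta j 0.
  by rewrite mxE -scalemxAr mxE mulrC.
pose c : 'cV[R]_n := \col_j (if 0 < a j then cp else cm).
have box (y : 'cV[R]_n) : (forall j, `|y j 0 - c j 0| <= delta) -> G y = 0.
  move=> hy; apply/eqP; rewrite -normr_le0 leNgt; apply/negP => Gy.
  have [d d0 hd] := cG y _ Gy.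
  pose z j := (y j 0 - c j 0) / delta.
  have z1 j : `|z j| <= 1.
    by rewrite normrM normfV (gtr0_norm delta0) ler_pdivrMr// mul1r.
  have e0 : 0 < d / (2 * delta) by rewrite divr_gt0// mulr_gt0.
  have d2 : 0 < d / 2 by lra.
  have [X hX] : exists X, forall j t, X <= t -> `|p (a j * t + theta j 0) - c j 0| < d / 2.
    have h j := p_lim_affine (theta j 0) (a0 j) d2.
    have [X hX] := choice h.
    exists (\sum_j `|X j|) => j t Xt; rewrite mxE; apply: hX; apply: le_trans Xt.
    apply: (le_trans (ler_norm _)); rewrite (bigD1 j)//= lerDl.
    by apply: sumr_ge0.
  have [t Xt ht] := sin_phases_dense X a0 inj z1 e0.
  suff /hd : forall j, `|map_mx sigma (W *m (t *: v) + theta) j 0 - y j 0| < d.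
    by rewrite G0 sub0r normrN ltxx.
  move=> j.
  rewrite mxE layE /sigma.
  have -> : y j 0 = c j 0 + delta * z j.
    by rewrite /z mulrC divfK ?gt_eqF// addrC subrK.
  have h1 := hX j t Xt.
  have h2 : `|delta * (sin (phase (a j) (theta j 0) t) - z j)| <= d / 2.
    rewrite normrM (gtr0_norm delta0) -ler_pdivlMl//.
    apply: (le_trans (ht j)); rewrite le_eqVlt; apply/orP; left; apply/eqP.
    by field; rewrite gt_eqF.
  have -> : p (a j * t + theta j 0) + delta * sin (expR ((a j * t + theta j 0) ^+ 4
      + (a j * t + theta j 0))) - (c j 0 + delta * z j) =
    (p (a j * t + theta j 0) - c j 0) + delta * (sin (phase (a j) (theta j 0) t) - z j).
    by rewrite /phase /phase_exponent; ring.
  by apply: (le_lt_trans (ler_normD _ _)); lra.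
move=> y.
(* The segment from the centre c of the box to y stays in the box for t < delta / K. *)
pose gamma (t : R) : 'cV[R]_n := c + t *: (y - c).
have gE t j : gamma t j 0 = t * (y j 0 - c j 0) + c j 0 by rewrite !mxE addrC.
have ag : analytic (fun t => G (gamma t)).
  apply: aG => j.
  have := analyticD (analyticZ (y j 0 - c j 0) (analytic_id R)) (analytic_cst (c j 0)).
  by congr analytic; apply/funext => t; rewrite gE mulrC.
pose K := 1 + \sum_j `|y j 0 - c j 0|.
have K0 : 0 < K by rewrite ltr_pwDl// sumr_ge0.
have g1 : gamma 1 = y by rewrite /gamma scale1r addrC subrK.
rewrite -g1; apply: (analytic_eq0 ag (divr_gt0 delta0 K0)) => t /andP[t0 tK].
apply: box => j; rewrite gE addrK normrM (gtr0_norm t0).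
apply: (@le_trans _ _ (t * K)); last by rewrite -ler_pdivlMr// ltW.
apply: ler_wpM2l; first exact: ltW.
rewrite /K (bigD1 j)//=.
have : 0 <= \sum_(i | i != j) `|y i 0 - c i 0| by exact: sumr_ge0.
lra.
Qed.

End Oscillation.

(** * Uniform approximation *)

Section BoundedVariation.
Variable R : realType.
Local Notation mu := (@lebesgue_measure R).
Variable rho : R -> R.
Hypothesis rho_C1 : piecewise_C1 rho.
Hypothesis rho_int : mu.-integrable setT (EFin \o derive1 rho).

(** Cumulative variation of [rho]: bounded, nondecreasing, and controlling the increments of
    [rho]. *)
Let V x := (\int[mu]_(t in `]-oo, x]) `|derive1 rho t|)%R.

Lemma integrable_norm_derive (D : set R) : measurable D ->
  mu.-integrable D (EFin \o (fun t => `|derive1 rho t|)).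
Proof.
move=> mD; apply: integrableS (integrable_norm rho_int) => //.
Qed.

Lemma variationB a b : a <= b -> V b - V a = (\int[mu]_(t in `]a, b]) `|derive1 rho t|)%R.
Proof.
move=> ab; rewrite /V; apply: Rintegral_itvB => //.
exact: integrable_norm_derive.
Qed.

Lemma variation_le a b : a <= b -> V a <= V b.
Proof. by move=> ab; rewrite -subr_ge0 variationB//; apply: Rintegral_ge0. Qed.

Lemma variation_smooth (S : set R) a b : a < b ->
  (forall x, ~ S x -> derivable rho x 1 /\ {for x, continuous (derive1 rho)}) ->
  (forall x, a <= x <= b -> ~ S x) -> `|rho b - rho a| <= V b - V a.
Proof.
move=> ab hS nS.
have crho := rho_C1.1.
have cd : {within `[a, b], continuous (derive1 rho)}.
  apply: continuous_in_subspaceT => x; rewrite inE /= in_itv /= => /nS nx.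
  by have [] := hS x nx.
have e : (\int[mu]_(x in `[a, b]) derive1 rho x)%R = rho b - rho a.
  rewrite /Rintegral (@continuous_FTC2 _ _ rho)//.
  split.
  - move=> x; rewrite in_itv /= => /andP[ax xb].
    have nx : ~ S x by apply: nS; rewrite !ltW.
    exact: (hS x nx).1.
  - exact/cvg_at_right_filter/crho.
  - exact/cvg_at_left_filter/crho.
have iab : mu.-integrable `[a, b] (EFin \o derive1 rho).
  exact: integrableS rho_int.
have h : `|rho b - rho a| <= (\int[mu]_(x in `[a, b]) `|derive1 rho x|)%R.
  by rewrite -e; apply: le_normr_Rintegral.
rewrite (variationB (ltW ab)); apply: (le_trans h).
rewrite Rintegral_itv_obnd_cbnd//.
by apply: integrable_norm_derive; exact: measurable_itv.
Qed.

(** Between consecutive breakpoints the interval is shrunk slightly at both ends, where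
    [variation_smooth] applies, and continuity of [rho] recovers the ends. An interval holds
    finitely many breakpoints, at which it is split. *)
Lemma variation_bound a b : a <= b -> `|rho b - rho a| <= V b - V a.
Proof.
have [crho [S [finS hS _]]] := rho_C1.
have base a' b' : a' <= b' -> (forall x, a' < x < b' -> ~ S x) ->
    `|rho b' - rho a'| <= V b' - V a'.
  rewrite le_eqVlt => /orP[/eqP ->|ab nS]; first by rewrite !subrr normr0.
  apply/ler_addgt0Pr => e e0.
  have e2 : 0 < e / 2 by lra.
  have /cvgrPdist_lt/(_ _ e2)[d1 /= d10 h1] : {for a', continuous rho} by exact: crho.
  have /cvgrPdist_lt/(_ _ e2)[d2 /= d20 h2] : {for b', continuous rho} by exact: crho.
  (* Dividing by 3 keeps r below both continuity radii and a' + r below b' - r. *)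
  pose r := Num.min (Num.min d1 d2) (b' - a') / 3.
  have r0 : 0 < r by rewrite divr_gt0// !lt_min d10 d20 subr_gt0.
  have r3 : r * 3 <= Num.min (Num.min d1 d2) (b' - a') by rewrite divfK.
  move: r3; rewrite !le_min => /andP[/andP[r1 r2] r3].
  have ha : `|rho a' - rho (a' + r)| < e / 2.
    by apply: h1; rewrite /ball_ /= opprD addrA subrr sub0r normrN gtr0_norm//; lra.
  have hb : `|rho b' - rho (b' - r)| < e / 2.
    by apply: h2; rewrite /ball_ /= opprB addrC subrK gtr0_norm//; lra.
  have hm : `|rho (b' - r) - rho (a' + r)| <= V (b' - r) - V (a' + r).
    apply: (variation_smooth (S := S)) => //; first lra.
    by move=> x /andP[x1 x2]; apply: nS; apply/andP; split; lra.
  have v1 : V a' <= V (a' + r) by apply: variation_le; lra.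
  have v2 : V (b' - r) <= V b' by apply: variation_le; lra.
  have -> : rho b' - rho a' = (rho b' - rho (b' - r)) - (rho a' - rho (a' + r)) +
    (rho (b' - r) - rho (a' + r)) by ring.
  apply: (le_trans (ler_normD _ _)).
  have := ler_normB (rho b' - rho (b' - r)) (rho a' - rho (a' + r)); lra.
have split_at c a' b' : `|rho c - rho a'| <= V c - V a' ->
    `|rho b' - rho c| <= V b' - V c -> `|rho b' - rho a'| <= V b' - V a'.
  move=> h1 h2; have := ler_distD (rho c) (rho b') (rho a'); lra.
have ind (s : seq R) a' b' : a' <= b' -> (forall x, a' < x < b' -> S x -> x \in s) ->
    `|rho b' - rho a'| <= V b' - V a'.
  elim: s a' b' => [|c s IHs] a' b' ab hs.
    by apply: base => // x xab Sx; have := hs x xab Sx.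
  case: (boolP (a' < c < b')) => [/andP[ac cb]|nc]; last first.
    apply: IHs => // x xab Sx; have := hs x xab Sx; rewrite inE => /orP[/eqP xc|//].
    by rewrite -xc xab in nc.
  apply: (split_at c); apply: IHs; try exact: ltW.
  - move=> x /andP[x1 x2] Sx; have := hs x; rewrite x1 (lt_trans x2 cb) inE => /(_ isT Sx).
    by case/orP => // /eqP xc; rewrite xc ltxx in x2.
  - move=> x /andP[x1 x2] Sx; have := hs x; rewrite x2 (lt_trans ac x1) inE => /(_ isT Sx).
    by case/orP => // /eqP xc; rewrite xc ltxx in x1.
move=> ab; have /finite_seqP [s sE] := finS a b.
apply: (ind s) => // x /andP[x1 x2] Sx.
have : [set` s] x by rewrite -sE; split => //=; rewrite in_itv /= !ltW.
by [].
Qed.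

Lemma limits_at_infinity (e : R) : 0 < e -> exists2 A : R, 0 < A &
  (forall x, A <= x -> `|rho x - rho A| <= e) /\
  (forall x, x <= - A -> `|rho x - rho (- A)| <= e).
Proof.
move=> e0.
pose C := (\int[mu]_t `|derive1 rho t|)%R.
have V0 x : 0 <= V x by apply: Rintegral_ge0.
have VC x : V x <= C.
  rewrite /C (_ : setT = `]-oo, x] `|` `]x, +oo[); last first.
    by rewrite -itv_bndbnd_setU// set_itvE.
  rewrite Rintegral_setU//=.
  - by rewrite lerDl; apply: Rintegral_ge0.
  - by apply: integrable_norm_derive; apply: measurableU.
  - apply/disj_setPS => y [/=]; rewrite !in_itv /= andbT => yx xy.
    by have := le_lt_trans yx xy; rewrite ltxx.
have hs : has_sup (range V) by split; [exists (V 0); exists 0|exists C => _ [x _ <-]].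
have hi : has_inf (range V) by split; [exists (V 0); exists 0|exists 0 => _ [x _ <-]].
have [_ [a1 _ <-] h1] := sup_adherent e0 hs.
have [_ [a2 _ <-] h2] := inf_adherent e0 hi.
(* Beyond a1, and before a2, the remaining variation is less than e. *)
pose A := 1 + `|a1| + `|a2|.
have a1A : a1 <= A by rewrite /A; have := ler_norm a1; have := normr_ge0 a2; lra.
have a2A : - A <= a2.
  by rewrite /A; have := ler_norm (- a2); rewrite normrN; have := normr_ge0 a1; lra.
have A0 : 0 < A by rewrite /A; have := normr_ge0 a1; have := normr_ge0 a2; lra.
exists A => //; split=> x xA.
  apply: (le_trans (variation_bound xA)).
  have : V x <= sup (range V) by apply: sup_upper_bound => //; exists x.
  have := variation_le a1A; lra.
rewrite distrC; apply: (le_trans (variation_bound xA)).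
have : inf (range V) <= V x by apply: ge_inf; [exact: hi.2|exists x].
have := variation_le a2A; lra.
Qed.

End BoundedVariation.

(** * Polynomial approximation in the Gompertz variable *)

Section Weierstrass.
Variable R : realType.

(* [bernstein n f] is \sum_k f k 'C(n, k) X^k (1 - X)^(n-k), by Pascal's rule. *)
Fixpoint bernstein (n : nat) (f : nat -> R) : {poly R} :=
  if n is n'.+1 then
    'X * bernstein n' (f \o S) + (1 - 'X) * bernstein n' f
  else (f 0%N)%:P.

Lemma bernsteinSE n f y : (bernstein n.+1 f).[y] =
  y * (bernstein n (f \o S)).[y] + (1 - y) * (bernstein n f).[y].
Proof. by rewrite /= !hornerE. Qed.

Lemma bernstein_affine n c K f y :
  (bernstein n (fun k => c + K * f k)).[y] = c + K * (bernstein n f).[y].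
Proof.
elim: n f => [|n IHn] f; first by rewrite !hornerE.
rewrite !bernsteinSE IHn (_ : _ \o S = fun k => c + K * (f \o S) k)// IHn; ring.
Qed.

(** Second moment about z of the binomial law with parameters n and y: variance plus squared bias. A
    general z suits the induction, since the shift of k replaces z by z - 1. *)
Lemma bernstein_variance n z y :
  (bernstein n (fun k => (k%:R - z) ^+ 2)).[y] = n%:R * (y * (1 - y)) + (n%:R * y - z) ^+ 2.
Proof.
elim: n z => [|n IHn] z; first by rewrite !hornerE /=; ring.
rewrite bernsteinSE IHn.
rewrite (_ : _ \o S = fun k => (k%:R - (z - 1)) ^+ 2) ?IHn; last first.
  by apply/funext => k /=; rewrite -(natr1 k); ring.
by rewrite -(natr1 n); ring.
Qed.

Lemma bernstein_le n f g y : 0 <= y <= 1 -> (forall k, (k <= n)%N -> f k <= g k) ->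
  (bernstein n f).[y] <= (bernstein n g).[y].
Proof.
move=> /andP[y0 y1]; elim: n f g => [|n IHn] f g h; first by rewrite !hornerE h.
rewrite !bernsteinSE; apply: lerD; apply: ler_wpM2l; rewrite ?subr_ge0//.
  by apply: IHn => k kn /=; exact: h.
by apply: IHn => k kn /=; apply: h; exact: leqW.
Qed.

(** Nearby points are handled by uniform continuity, obtained from compactness of [0, 1]; for points
    at distance at least d the quadratic term already exceeds twice the maximum of |g|. *)
Lemma uniform_quadratic_modulus (g : R -> R) (e : R) : continuous g -> 0 < e ->
  exists2 K : R, 0 <= K & forall x y : R, 0 <= x <= 1 -> 0 <= y <= 1 ->
    `|g x - g y| <= e + K * (x - y) ^+ 2.
Proof.
move=> cg e0.
have e2 : 0 < e / 2 by lra.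
have [d d0 hd] : exists2 d : R, 0 < d & forall x y : R, 0 <= x <= 1 -> `|x - y| < d ->
    `|g x - g y| < e.
  have /compact_near_coveringP := @segment_compact R 0 1.
  move=> /(_ R (0 : R)^'+ (fun d x => forall y, `|x - y| < d -> `|g x - g y| < e)).
  case.
    move=> x _.
    have /cvgrPdist_lt/(_ _ e2)[r /= r0 hr] : {for x, continuous g} by exact: cg.
    exists ([set x' | `|x - x'| < r / 2], [set d | d < r / 2]) => /=.
      split; first by exists (r / 2) => //=; lra.
      by apply: nbhs_right_lt; lra.
    move=> [x' d'] /= [xx' d'r] y xy.
    have h1 : `|g x - g x'| < e / 2 by apply: hr => /=; lra.
    have h2 : `|g x - g y| < e / 2.
      by apply: hr => /=; have := ler_distD x' x y; lra.
    by have := ler_distD (g x) (g x') (g y); rewrite (distrC (g x') (g x)); lra.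
  move=> r /= r0 hr; exists (r / 2); first by lra.
  have r2 : 0 < r / 2 by lra.
  have br : ball_ [eta Num.Def.normr] 0 r (r / 2).
    by rewrite /= sub0r normrN gtr0_norm; lra.
  by move=> x y x01; apply: (hr _ br r2); rewrite /= in_itv.
have cn : {within `[0, 1], continuous (fun x => `|g x|)}.
  apply: continuous_subspaceT => x; apply: continuous_comp; first exact: cg.
  exact: norm_continuous.
have [c _ hc] := EVT_max (ler01 : 0 <= 1 :> R) cn.
pose M : R := `|g c|.
have M0 : 0 <= M by exact: normr_ge0.
have K0 : 0 <= 2 * M / d ^+ 2 by apply: divr_ge0; [lra|exact: sqr_ge0].
exists (2 * M / d ^+ 2) => //.
move=> x y x01 y01.
have [xy|xy] := ltP `|x - y| d.
  have := hd x y x01 xy; have : 0 <= 2 * M / d ^+ 2 * (x - y) ^+ 2.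
    by apply: mulr_ge0 => //; exact: sqr_ge0.
  lra.
have gx : `|g x| <= M by apply: hc; rewrite in_itv.
have gy : `|g y| <= M by apply: hc; rewrite in_itv.
have : 2 * M <= 2 * M / d ^+ 2 * (x - y) ^+ 2.
  rewrite mulrAC ler_pdivlMr ?exprn_gt0//; apply: ler_wpM2l; first by lra.
  by rewrite -[leRHS]real_normK ?num_real//; apply: lerXn2r; rewrite ?nnegrE// ltW.
have := ler_normB (g x) (g y); lra.
Qed.

(** Bernstein operators preserve inequalities and constants. They send the quadratic modulus around
    y to e / 2 + K y (1 - y) / n, which is at most e for the chosen n. *)
Lemma weierstrass (g : R -> R) (e : R) : continuous g -> 0 < e ->
  exists p : {poly R}, forall y : R, 0 <= y <= 1 -> `|g y - p.[y]| <= e.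
Proof.
move=> cg e0; have e2 : 0 < e / 2 by lra.
have [K K0 hK] := uniform_quadratic_modulus cg e2.
pose n := (Num.truncn (2 * K / e)).+1.
have nK : K / n%:R <= e / 2.
  rewrite ler_pdivrMr ?ltr0n// -ler_pdivrMl//.
  have -> : (e / 2)^-1 * K = 2 * K / e by field; rewrite gt_eqF.
  by apply: ltW; exact: truncnS_gt.
have n0 : n%:R != 0 :> R by rewrite pnatr_eq0.
exists (bernstein n (fun k => g (k%:R / n%:R))) => y y01; have /andP[y0 y1] := y01.
have kn k : (k <= n)%N -> 0 <= (k%:R / n%:R : R) <= 1.
  by move=> kn; rewrite divr_ge0//= ler_pdivrMr ?ltr0n// mul1r ler_nat.
have var : e / 2 + (K / n%:R ^+ 2) * (bernstein n (fun k => (k%:R - n%:R * y) ^+ 2)).[y] <= e.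
  rewrite bernstein_variance subrr expr0n /= addr0.
  have -> : K / n%:R ^+ 2 * (n%:R * (y * (1 - y))) = K * (y * (1 - y) / n%:R) by field.
  suff : K * (y * (1 - y) / n%:R) <= K / n%:R by lra.
  by apply: ler_wpM2l => //; rewrite ler_pdivrMr ?ltr0n// mulVf//; nra.
have quad k : (k <= n)%N -> `|g (k%:R / n%:R) - g y| <=
    e / 2 + (K / n%:R ^+ 2) * (k%:R - n%:R * y) ^+ 2.
  move=> kn'; apply: (le_trans (hK _ _ (kn k kn') y01)).
  rewrite le_eqVlt; apply/orP; left; apply/eqP; congr (_ + _); field.
  exact: n0.
have up : (bernstein n (fun k => g (k%:R / n%:R))).[y] <= g y + e.
  apply: (le_trans (bernstein_le (g := fun k => (g y + e / 2) +
    (K / n%:R ^+ 2) * (k%:R - n%:R * y) ^+ 2) y01 _)).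
    by move=> k /quad; rewrite ler_norml => /andP[]; lra.
  by rewrite bernstein_affine; lra.
have lo : g y - e <= (bernstein n (fun k => g (k%:R / n%:R))).[y].
  apply: (le_trans _ (bernstein_le (f := fun k => (g y - e / 2) +
    (- (K / n%:R ^+ 2)) * (k%:R - n%:R * y) ^+ 2) y01 _)); last first.
    by move=> k /quad; rewrite ler_norml => /andP[]; lra.
  by rewrite bernstein_affine; lra.
by rewrite ler_norml; apply/andP; split; lra.
Qed.

(** A sigmoid built from exponentials alone, so that it extends to an entire function. *)
Definition gompertz (x : R) : R := expR (- expR (- x)).

Lemma gompertz_le : {mono gompertz : x y / x <= y}.
Proof. by move=> x y; rewrite /gompertz ler_expR lerN2 ler_expR lerN2. Qed.

Lemma gompertz_gt0 x : 0 < gompertz x.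
Proof. exact: expR_gt0. Qed.

Lemma gompertz_lt1 x : gompertz x < 1.
Proof. by rewrite -expR0 ltr_expR oppr_lt0 expR_gt0. Qed.

Lemma gompertzK x : - ln (- ln (gompertz x)) = x.
Proof. by rewrite /gompertz expRK opprK expRK opprK. Qed.

Lemma gompertz_poly_approx (rho : R -> R) (e A : R) : continuous rho -> 0 < e -> 0 < A ->
  (forall x, A <= x -> `|rho x - rho A| <= e) ->
  (forall x, x <= - A -> `|rho x - rho (- A)| <= e) ->
  exists p : {poly R}, forall x, `|rho x - p.[gompertz x]| <= 2 * e.
Proof.
move=> crho e0 A0 hp hm.
pose lo := gompertz (- A); pose hi := gompertz A.
have lohi : lo <= hi by rewrite gompertz_le; lra.
(* Clamping to [lo, hi], inside ]0, 1[, makes the pullback of [rho] by the inverse of [gompertz]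
   continuous on all of R. Beyond A and - A it freezes [rho] at its end values, at a cost of at most
   e. *)
pose cl y := Num.max lo (Num.min hi y).
have cl0 y : 0 < cl y by rewrite lt_max gompertz_gt0.
have cl1 y : cl y < 1 by rewrite gt_max gompertz_lt1 gt_min gompertz_lt1.
pose g y := rho (- ln (- ln (cl y))).
have cg : continuous g.
  move=> y; apply: (continuous_comp (f := fun y => - ln (- ln (cl y)))); last exact: crho.
  apply: continuousN.
  apply: (continuous_comp (f := fun y => - ln (cl y))); last first.
    by apply: continuous_ln; rewrite oppr_gt0 ln_lt0// cl0 cl1.
  apply: continuousN; apply: (continuous_comp (f := cl)); last exact: continuous_ln.
  apply: continuous_max; first exact: cvg_cst.
  by apply: continuous_min; [exact: cvg_cst|exact: cvg_id].
have [p hpp] := weierstrass cg e0; exists p => x.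
have h01 : 0 <= gompertz x <= 1 by rewrite !ltW ?gompertz_gt0 ?gompertz_lt1.
suff : `|rho x - g (gompertz x)| <= e.
  by have := hpp _ h01; have := ler_distD (g (gompertz x)) (rho x) p.[gompertz x]; lra.
rewrite /g /cl.
have [xA|Ax] := leP A x.
  by rewrite min_l ?gompertz_le// max_r// gompertzK; exact: hp.
rewrite min_r; last by rewrite gompertz_le ltW.
have [xA|Ax'] := leP x (- A).
  by rewrite max_l ?gompertz_le// gompertzK; exact: hm.
by rewrite max_r ?gompertzK ?subrr ?normr0 ?gompertz_le; rewrite ?ltW.
Qed.

Lemma gompertz_pinfty (e : R) : 0 < e -> exists X, forall x, X <= x -> `|gompertz x - 1| < e.
Proof.
move=> e0; exists (- ln (Num.min e 1 / 2)) => x hx.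
have m0 : 0 < Num.min e 1 / 2 by rewrite divr_gt0// lt_min e0 ltr01.
have h : expR (- x) <= Num.min e 1 / 2.
  by rewrite -(lnK m0) ler_expR; lra.
have me : Num.min e 1 <= e by rewrite ge_min lexx.
have := expR_ge1Dx (- expR (- x)); have := gompertz_lt1 x; rewrite /gompertz.
by move=> h1 h2; rewrite ltr0_norm; lra.
Qed.

Lemma gompertz_ninfty (e : R) : 0 < e -> exists X, forall x, x <= X -> `|gompertz x - 0| < e.
Proof.
move=> e0; exists (- e^-1) => x hx.
have h1 := expR_ge1Dx (- x).
have h2 := expR_ge1Dx (expR (- x)).
have eV : 0 < e^-1 by rewrite invr_gt0.
rewrite subr0 gtr0_norm ?gompertz_gt0// /gompertz expRN.
by rewrite invf_plt ?posrE ?expR_gt0//; lra.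
Qed.

(** [P X x] stands for [X <= x] or [x <= X], so that both ends are treated at once. *)
Lemma poly_gompertz_limit (p : {poly R}) (P : R -> R -> Prop) (l : R) :
  (forall e : R, 0 < e -> exists X, forall x, P X x -> `|gompertz x - l| < e) ->
  forall e : R, 0 < e -> exists X, forall x, P X x -> `|p.[gompertz x] - p.[l]| < e.
Proof.
move=> h e e0.
have /cvgrPdist_lt/(_ _ e0)[d /= d0 hd] : {for l, continuous (fun y => p.[y])}.
  exact: continuous_horner.
have [X hX] := h d d0; exists X => x /hX; rewrite distrC => hx.
by rewrite distrC; exact: hd.
Qed.

End Weierstrass.

(** * The complex activation *)

Section Entire.
Variable K : numFieldType.
Implicit Types f g : K^o -> K^o.

Definition entire f : Prop := forall z : K^o, derivable f z 1.

Lemma entire_near f (z : K^o) : entire f -> \forall w \near z, derivable f w 1.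
Proof. by move=> df; apply: (@filterE _ (nbhs z)) => w; exact: df. Qed.

Lemma entire_cst (c : K^o) : entire (fun=> c).
Proof. by move=> z; exact: derivable_cst. Qed.

Lemma entire_id : entire id.
Proof. by move=> z; exact: derivable_id. Qed.

Lemma entireD f g : entire f -> entire g -> entire (fun z => f z + g z).
Proof. by move=> df dg z; apply: derivableD. Qed.

Lemma entireN f : entire f -> entire (fun z => - f z).
Proof. by move=> df z; apply: derivableN. Qed.

Lemma entireM f g : entire f -> entire g -> entire (fun z => f z * g z).
Proof. by move=> df dg z; apply: derivableM. Qed.

Lemma entireX f n : entire f -> entire (fun z => f z ^+ n).
Proof.
move=> df; elim: n => [|n IHn]; first exact: entire_cst.
have -> : (fun z => f z ^+ n.+1) = (fun z => f z * f z ^+ n).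
  by apply/funext => z; rewrite exprS.
exact: entireM.
Qed.

Lemma entire_comp f g : entire f -> entire g -> entire (fun z => f (g z)).
Proof.
move=> df dg z; apply/derivable1_diffP.
by apply: (@differentiable_comp _ _ _ _ g f); apply/derivable1_diffP.
Qed.

Lemma entire_horner (q : {poly K}) f : entire f -> entire (fun z => q.[f z]).
Proof.
move=> df; elim/poly_ind: q => [|q c IHq].
  have -> : (fun z => (0 : {poly K}).[f z]) = (fun=> 0).
    by apply/funext => z; rewrite horner0.
  exact: entire_cst.
have -> : (fun z => (q * 'X + c%:P).[f z]) = (fun z => q.[f z] * f z + c).
  by apply/funext => z; rewrite !hornerE.
by apply: entireD; [exact: entireM|exact: entire_cst].
Qed.

Lemma entire_continuous f : entire f -> continuous f.
Proof.
by move=> df z; apply: differentiable_continuous; apply/derivable1_diffP; exact: df.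
Qed.

(** By continuity of f at z the product tends to 0, and limits are unique; an entire function
    therefore has no [pole]. *)
Lemma entire_pole_limit f (z c : K^o) n : entire f ->
  (w - z) ^+ n.+1 * f w @[w --> z^'] --> c -> c = 0.
Proof.
move=> df h.
have dg : entire (fun w => (w - z) ^+ n.+1 * f w).
  apply: entireM => //; apply: entireX; apply: entireD; first exact: entire_id.
  exact: entire_cst.
have h0 : (w - z) ^+ n.+1 * f w @[w --> z^'] --> ((z - z) ^+ n.+1 * f z : K^o).
  apply: cvg_within_filter; exact: (entire_continuous dg).
have e : c = (z - z) ^+ n.+1 * f z by apply: cvg_unique h h0.
by rewrite e subrr expr0n mul0r.
Qed.

End Entire.

(** * The complex exponential and sine *)

Section ComplexExponential.
Variable R : realType.
Local Notation C := (R[i]^o).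

(** Both sides follow from exp x >= 1 + x: taken at - a, it gives exp a <= 1 / (1 - a). *)
Lemma expR_quadratic (a : R) : `|a| <= 2^-1 -> `|expR a - 1 - a| <= 2 * a ^+ 2.
Proof.
rewrite ler_norml => /andP[a1 a2].
have h1 := expR_ge1Dx a; have h2 := expR_ge1Dx (- a).
have e1 : expR a * expR (- a) = 1 by rewrite expRxMexpNx_1.
have e0 := expR_gt0 a.
have h3 : expR a * (1 - a) <= 1 by rewrite -e1; apply: ler_wpM2l; [exact: ltW|lra].
rewrite ger0_norm; last by lra.
suff : expR a <= 1 + a + 2 * a ^+ 2 by lra.
rewrite -(@ler_pM2r _ (1 - a)); last by lra.
apply: (le_trans h3); nra.
Qed.

Lemma sin_abs_le (b : R) : `|sin b| <= `|b|.
Proof.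
have [b0|/ltW b0] := leP 0 b.
  by have := sin_lipschitz b0; rewrite sin0 !subr0 (ger0_norm b0).
by have := sin_lipschitz b0; rewrite sin0 !sub0r normrN (ler0_norm b0).
Qed.

Lemma cos_quadratic (b : R) : `|cos b - 1| <= b ^+ 2 / 2.
Proof.
have -> : cos b - 1 = - (2 * sin (b / 2) ^+ 2).
  rewrite [in LHS](splitr b) cosD; have := cos2Dsin2 (b / 2); rewrite !expr2; lra.
rewrite normrN normrM normrX ger0_norm//.
have h : `|sin (b / 2)| ^+ 2 <= `|b / 2| ^+ 2.
  by apply: lerXn2r; rewrite ?nnegrE//; exact: sin_abs_le.
have e : `|b / 2| ^+ 2 = b ^+ 2 / 4 by rewrite real_normK ?num_real//; field.
by rewrite e in h; lra.
Qed.

Lemma sin_quadratic (b : R) : `|b| <= 2^-1 -> `|sin b - b| <= b ^+ 2.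
Proof.
have pos (c : R) : 0 <= c -> c <= 2^-1 -> `|sin c - c| <= c ^+ 2.
  move=> c0 c1.
  have d (x : R) : is_derive x 1 (@sin R - id) (cos x - 1) by apply: is_derive_eq.
  (* Integrating |cos x - 1| <= x^2 / 2 gives c^3 / 6, which is below c^2 on this range. *)
  have := @power_bound_integrate R (@sin R - id) (fun x => cos x - 1) 0 c 6^-1 2 c0 d.
  rewrite !fctE sin0 !subr0 => h; apply: le_trans (h _ _) _ => //.
    move=> x _; rewrite subr0; apply: (le_trans (cos_quadratic x)).
    by rewrite le_eqVlt; apply/orP; left; apply/eqP; field.
  by rewrite exprS; have := sqr_ge0 c; nra.
move=> hb; have [b0|b0] := leP 0 b.
  by apply: pos => //; rewrite ger0_norm in hb.
have := pos (- b); rewrite sinN sqrrN -opprB opprK normrN addrC => h.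
have -> : `|sin b - b| = `|b - sin b| by rewrite distrC.
move: hb; rewrite ltr0_norm// => hb.
by rewrite distrC; apply: h => //; lra.
Qed.

Definition cexp (z : C) : C :=
  (expR (complex.Re z) * cos (complex.Im z))
  +i* (expR (complex.Re z) * sin (complex.Im z)).

Lemma cexpD (z w : C) : cexp (z + w) = cexp z * cexp w.
Proof.
case: z w => [a b] [c d]; rewrite /cexp /=; simpc.
by rewrite expRD cosD sinD; congr (_ +i* _); ring.
Qed.

Lemma cexp_real (x : R) : cexp x%:C = (expR x)%:C.
Proof. by rewrite /cexp /= cos0 sin0 mulr1 mulr0. Qed.

(** The modulus as a real number; the norm on [R[i]] takes its values in [R[i]]. *)
Let cabs (z : R[i]) : R := Num.sqrt (complex.Re z ^+ 2 + complex.Im z ^+ 2).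

Lemma cabs_leD (z : R[i]) : cabs z <= `|complex.Re z| + `|complex.Im z|.
Proof.
rewrite /cabs; move: (complex.Re z) (complex.Im z) => a b.
have -> : `|a| + `|b| = Num.sqrt ((`|a| + `|b|) ^+ 2).
  by rewrite sqrtr_sqr [RHS]ger0_norm// addr_ge0.
apply: ler_wsqrtr; rewrite sqrrD !real_normK ?num_real//.
have : 0 <= `|a| * `|b| by rewrite mulr_ge0.
lra.
Qed.

Lemma Re_le_cabs (z : R[i]) : `|complex.Re z| <= cabs z.
Proof. by rewrite -sqrtr_sqr; apply: ler_wsqrtr; rewrite lerDl sqr_ge0. Qed.

Lemma Im_le_cabs (z : R[i]) : `|complex.Im z| <= cabs z.
Proof. by rewrite -sqrtr_sqr; apply: ler_wsqrtr; rewrite lerDr sqr_ge0. Qed.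

(** Complex differentiability at 0, reduced to real estimates: the real and imaginary parts of the
    remainder each contribute at most 4 |h|^2. *)
Lemma cexp_quadratic (h : C) : `|h| <= 2^-1 -> `|cexp h - 1 - h| <= 8 * `|h| ^+ 2.
Proof.
have -> : 2^-1 = (2^-1)%:C :> R[i] by rewrite fmorphV rmorph_nat.
have -> : 8 = 8%:C :> R[i] by rewrite rmorph_nat.
rewrite !normc_def -/(cabs h) -/(cabs (cexp h - 1 - h)) -rmorphXn -rmorphM !lecR => r1.
apply: (le_trans (cabs_leD _)).
have := Im_le_cabs h; have := Re_le_cabs h; move: (cabs h) r1 => r r1.
case: h => a b /= ha hb; rewrite !subr0.
have a1 : `|a| <= 2^-1 by lra.
have b1 : `|b| <= 2^-1 by lra.
have qa := expR_quadratic a1; have cb := cos_quadratic b; have sb := sin_quadratic b1.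
have a20 := normr_ge0 a; have b20 := normr_ge0 b.
have aE : a ^+ 2 = `|a| ^+ 2 by rewrite real_normK ?num_real.
have bE : b ^+ 2 = `|b| ^+ 2 by rewrite real_normK ?num_real.
have ar : a ^+ 2 <= r ^+ 2 by rewrite aE; apply: lerXn2r; rewrite ?nnegrE//; lra.
have br : b ^+ 2 <= r ^+ 2 by rewrite bE; apply: lerXn2r; rewrite ?nnegrE//; lra.
have ea2 : expR a <= 2.
  have := ler_norm (expR a - 1 - a); have := ler_norm a.
  have : a ^+ 2 <= 4^-1 by rewrite aE; nra.
  lra.
have ea0 := expR_gt0 a.
have r20 := sqr_ge0 r.
have ea1 : `|expR a - 1| <= 2 * `|a|.
  have -> : expR a - 1 = (expR a - 1 - a) + a by ring.
  apply: (le_trans (ler_normD _ _)); nra.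
have re : `|expR a * cos b - 1 - a| <= 4 * r ^+ 2.
  have -> : expR a * cos b - 1 - a = (expR a - 1 - a) + expR a * (cos b - 1) by ring.
  apply: (le_trans (ler_normD _ _)); rewrite normrM (gtr0_norm ea0).
  have : expR a * `|cos b - 1| <= 2 * (b ^+ 2 / 2) by apply: ler_pM => //; exact: ltW.
  lra.
have im : `|expR a * sin b - b| <= 4 * r ^+ 2.
  have -> : expR a * sin b - b = expR a * (sin b - b) + b * (expR a - 1) by ring.
  apply: (le_trans (ler_normD _ _)); rewrite !normrM (gtr0_norm ea0).
  have : expR a * `|sin b - b| <= 2 * b ^+ 2 by apply: ler_pM => //; exact: ltW.
  have : `|b| * `|expR a - 1| <= `|b| * (2 * `|a|) by apply: ler_wpM2l.
  have : `|b| * `|a| <= r * r by apply: ler_pM.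
  rewrite -expr2; lra.
lra.
Qed.

Lemma cexp_entire : entire cexp.
Proof.
move=> z; apply/cvg_ex; exists (cexp z); apply/cvgrPdist_lt => e e0.
have M0 : 0 < 8 * (1 + `|cexp z|) by rewrite mulr_gt0// ltr_pwDl.
near=> h.
have hne : h != 0 by near: h; exact: nbhs_dnbhs_neq.
have h1 : `|h| < 2^-1 by near: h; apply: dnbhs0_lt; rewrite invr_gt0.
have h2 : `|h| < e / (8 * (1 + `|cexp z|)).
  by near: h; apply: dnbhs0_lt; rewrite divr_gt0.
rewrite /= /GRing.scale /= mulr1 cexpD.
(* The functional equation transports the estimate at 0 to the point z. *)
have -> : cexp z - h^-1 * (cexp h * cexp z - cexp z) =
   - (cexp z * (cexp h - 1 - h) / h) by field.
rewrite normrN !normrM normfV ltr_pdivrMr ?normr_gt0//.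
have q := cexp_quadratic (ltW h1).
apply: (@le_lt_trans _ _ (`|cexp z| * (8 * `|h| ^+ 2))); first exact: ler_wpM2l.
rewrite expr2 !mulrA ltr_pM2r ?normr_gt0//.
move: h2; rewrite ltr_pdivlMr//; apply: le_lt_trans.
rewrite [X in _ <= X]mulrC; apply: ler_wpM2r => //.
by rewrite mulrC; apply: ler_wpM2l => //; rewrite lerDr.
Unshelve. all: by end_near.
Qed.

Definition csin (z : C) : C := (2 * 'i)^-1 * (cexp ('i * z) - cexp (- ('i * z))).

Lemma csin_real (x : R) : csin x%:C = (sin x)%:C.
Proof.
have e1 : cexp ('i * x%:C) = cos x +i* sin x.
  by rewrite /cexp /=; simpc; rewrite /= expR0 !mul1r.
have e2 : cexp (- ('i * x%:C)) = cos x -i* sin x.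
  by rewrite /cexp /=; simpc; rewrite /= ?oppr0 expR0 !mul1r cosN sinN.
have i0 : 2 * 'i != 0 :> R[i].
  by rewrite mulf_neq0 ?pnatr_eq0// eq_complex /= oner_eq0 andbF.
rewrite /csin e1 e2; apply: (mulfI i0); rewrite mulrA mulfV// mul1r.
have -> : 2 * 'i = 0 +i* 2 :> R[i].
  by rewrite mulr_natl mulr2n; apply/eqP; rewrite eq_complex /= addr0 !eqxx.
by simpc; congr (_ +i* _); ring.
Qed.

Lemma csin_entire : entire csin.
Proof.
have di : entire (fun z : C => 'i * z).
  by apply: entireM; [exact: entire_cst|exact: entire_id].
apply: entireM; first exact: entire_cst.
apply: entireD; first exact: (entire_comp cexp_entire di).
exact: entireN (entire_comp cexp_entire (entireN di)).
Qed.

Variables (p : {poly R}) (delta : R).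

Definition activation (z : C) : C :=
  (map_poly (real_complex R) p).[cexp (- cexp (- z))]
  + delta%:C * csin (cexp (z ^+ 4 + z)).

Lemma activation_entire : entire activation.
Proof.
apply: entireD.
  apply: entire_horner; apply: (entire_comp cexp_entire); apply: entireN.
  apply: (entire_comp cexp_entire); apply: entireN; exact: entire_id.
apply: entireM; first exact: entire_cst.
apply: (entire_comp csin_entire); apply: (entire_comp cexp_entire).
by apply: entireD; [apply: entireX|]; exact: entire_id.
Qed.

Lemma activation_real (x : R) :
  activation x%:C = (p.[gompertz x] + delta * sin (expR (x ^+ 4 + x)))%:C.
Proof.
rewrite /activation -!rmorphN cexp_real -rmorphN cexp_real horner_map.
by rewrite -rmorphXn -rmorphD cexp_real csin_real -rmorphM -rmorphD.
Qed.

Lemma entire_not_pole (f : C -> C) z : entire f -> ~ pole f z.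
Proof.
move=> df [_ [n [c c0 h]]].
by move/eqP: c0; apply; exact: (entire_pole_limit df h).
Qed.

End ComplexExponential.

(** * Bounds and analyticity of the activation, and the conclusion *)

Lemma poly_gompertz_bounded (R : realType) (p : {poly R}) :
  exists B, forall x, `|p.[gompertz x]| <= B.
Proof.
exists (\sum_(i < size p) `|p`_i|) => x; rewrite horner_coef.
apply: (le_trans (ler_norm_sum _ _ _)); apply: ler_sum => i _.
rewrite normrM -[leRHS]mulr1; apply: ler_wpM2l => //.
rewrite normrX (gtr0_norm (gompertz_gt0 x)); apply: exprn_ile1.
  exact/ltW/gompertz_gt0.
exact/ltW/gompertz_lt1.
Qed.

Lemma poly_gompertz_analytic (R : realType) (p : {poly R}) :
  analytic (fun x => p.[gompertz x]).
Proof.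
have -> : (fun x => p.[gompertz x]) =
    fun x => \sum_(i < size p) p`_i * gompertz x ^+ i.
  by apply/funext => x; rewrite horner_coef.
apply: analytic_sum => i; apply: analyticZ.
apply: (analytic_comp (exprn_analytic R i)).
have aN (f : R -> R) : analytic f -> analytic (fun x => - f x).
  by move=> /(analyticZ (-1)); congr analytic; apply/funext => x; rewrite mulN1r.
apply: (analytic_comp (expR_analytic R)); apply: (aN).
by apply: (analytic_comp (expR_analytic R)); apply: (aN); exact: analytic_id.
Qed.

Lemma oscillation_analytic (R : realType) :
  analytic (fun x : R => sin (expR (x ^+ 4 + x))).
Proof.
apply: (analytic_comp (sin_analytic R)); apply: (analytic_comp (expR_analytic R)).
by apply: analyticD; [exact: exprn_analytic|exact: analytic_id].
Qed.

Lemma Linfty_norm_le (R : realType) (f : R -> R) (B : R) : 0 <= B ->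
  (forall x, `|f x| <= B) -> ('N[@lebesgue_measure R]_+oo [EFin \o f] <= B%:E)%E.
Proof.
move=> B0 hf; rewrite unlock /=; case: ifP => _; last by rewrite lee_fin.
by apply/ess_sup_inf.ess_supP; apply: nearW => x /=; rewrite lee_fin.
Qed.

Theorem theorem1 (R : realType) (Din Dout : nat)
    (Din_gt0 : (0 < Din)%N) (Dout_gt0 : (0 < Dout)%N)
    (rho : R -> R) (rho_C1 : piecewise_C1 rho) (rho_BV : BV (derive1 rho))
    (eps : R) (eps_gt0 : 0 < eps) :
  exists (D : set R[i]^o) (sigma : R[i]^o -> R[i]^o),
    let sigmaR : R -> R := fun x => complex.Re (sigma x%:C) in
    [/\ open D /\ (forall x : R, D x%:C),
        meromorphic_on D sigma,
        (forall x : R, ~ pole sigma x%:C /\ sigma x%:C = (sigmaR x)%:C),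
        ('N[@lebesgue_measure R]_+oo [EFin \o (rho \- sigmaR)%R]
           < eps%:E)%E &
        identifiable (networks_nc R Din Dout) sigmaR (@isomorphic R Din Dout)].
Proof.
have d0 : 0 < eps / 8 by lra.
have [A A0 [hp hm]] := limits_at_infinity rho_C1 rho_BV.1 d0.
have [p pE] := gompertz_poly_approx rho_C1.1 d0 A0 hp hm.
exists setT, (activation p (eps / 8)) => sigmaR.
have sE : sigmaR = fun x => p.[gompertz x] + eps / 8 * sin (expR (x ^+ 4 + x)).
  by apply/funext => x; rewrite /sigmaR activation_real.
have dA := @activation_entire R p (eps / 8).
split.
- by split; [exact: openT|].
- by move=> z _; left; exact: entire_near.
- move=> x; split; first exact: entire_not_pole.
  by rewrite sE activation_real.
- apply: (@le_lt_trans _ _ (3 / 8 * eps)%:E); last by rewrite lte_fin; lra.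
  apply: Linfty_norm_le; first by lra.
  move=> x; rewrite /= sE.
  have -> : rho x - (p.[gompertz x] + eps / 8 * sin (expR (x ^+ 4 + x))) =
    (rho x - p.[gompertz x]) - eps / 8 * sin (expR (x ^+ 4 + x)) by ring.
  apply: (le_trans (ler_normB _ _)); rewrite normrM (gtr0_norm d0).
  have s1 : `|sin (expR (x ^+ 4 + x))| <= 1 by rewrite ler_norml sin_geN1 sin_le1.
  have := pE x; have := ler_wpM2l (ltW d0) s1; lra.
- rewrite sE; have [B hB] := poly_gompertz_bounded p.
  apply: (@networks_nc_identifiable _ _ _ _ (B + eps / 8)).
  + apply: analyticD; first exact: poly_gompertz_analytic.
    by apply: analyticZ; exact: oscillation_analytic.
  + move=> m n W th; apply: (@oscillating_layer_independent R _ _ p.[1] p.[0] d0).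
    * exact: (poly_gompertz_limit p (P := fun X x => X <= x) (@gompertz_pinfty R)).
    * exact: (poly_gompertz_limit p (P := fun X x => x <= X) (@gompertz_ninfty R)).
  + move=> x; apply: (le_trans (ler_normD _ _)); rewrite normrM (gtr0_norm d0).
    have s1 : `|sin (expR (x ^+ 4 + x))| <= 1 by rewrite ler_norml sin_geN1 sin_le1.
    have := hB x; have := ler_wpM2l (ltW d0) s1; lra.
Qed.
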